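(* Let $G$ be a finite group, let $\Gamma=\widehat{G}\times G$ be the group of group-like elements of $\mathcal{D}(G)$, and let $N$ be the kernel of the restriction homomorphism $\mathrm{Aut}(\mathcal{D}(G))\to\mathrm{Aut}(\Gamma)$. Then $$N\cong\mathrm{Aut}_{c'}(G)\ltimes\mathrm{Hom}(Z(G)\cap G',Z(G)).$$ Thus $N=1$ if and only if $Z(G)\cap G'=1$. In particular, if $G$ is abelian or centerless, then $N=1$. At the other extreme, $Z(G)\leq G'$ if and only if $N=\Lambda_c(G)$, and the kernel in this case is non-trivial precisely when $Z(G)\neq1$.
   Context: The base field $\mathbbm{k}$ is algebraically closed of characteristic zero. For a finite group $G$, $\mathbbm{k}^G$ is the linear dual of $\mathbbm{k}G$, with dual basis $\{e_g\}_{g\in G}$ and identity $\varepsilon=\sum_{g}e_g$; $\widehat{G}=\mathrm{Hom}(G,\mathbbm{k}^\times)$ is the group of group-like elements of $\mathbbm{k}^G$. The Drinfeld double $\mathcal{D}(G)$ is the Hopf algebra with basis $e_g\# h$ ($g,h\in G$), multiplication $(e_g\# g')(e_h\# h')=\delta_{g,\,g'hg'^{-1}}\,e_g\# g'h'$, unit $\varepsilon\# 1$, and coalgebra structure $(\mathbbm{k}^G)^{\mathrm{cop}}\otimes\mathbbm{k}G$. $\mathrm{Aut}(\mathcal{D}(G))$ is its group of Hopf algebra automorphisms. The group-likes of $\mathcal{D}(G)$ are the elements $\chi\# g$ with $\chi\in\widehat{G}$, $g\in G$, identified with $(\chi,g)\in\Gamma$. Every Hopf algebra endomorphism $\psi$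 of $\mathcal{D}(G)$ is determined by its components $(p,u,r,v)$, where $u(a)=(\mathrm{id}\otimes\varepsilon)\psi(a\#1)\in\mathbbm{k}^G$, $p(a)=(\mathrm{ev}_1\otimes\mathrm{id})\psi(a\#1)\in\mathbbm{k}G$, $r(g)=(\mathrm{id}\otimes\varepsilon)\psi(\varepsilon\# g)\in\widehat{G}$, $v(g)=(\mathrm{ev}_1\otimes\mathrm{id})\psi(\varepsilon\# g)\in G$ for $a\in\mathbbm{k}^G$, $g\in G$ (here $\mathrm{ev}_1(f)=f(1)$ and $\varepsilon$ in the second tensor factor is the counit of $\mathbbm{k}G$); one has $\psi(a\# g)=u(a_{(1)})r(g)\# p(a_{(2)})v(g)$, with Sweedler notation in $(\mathbbm{k}^G)^{\mathrm{cop}}$. $\Lambda_c(G)$ is the subgroup of all automorphisms with $v=\mathrm{id}$ and $r$ trivial ($r(g)=\varepsilon$ for all $g$). $G'$ is the derived subgroup. $\mathrm{Aut}_{c'}(G)$ is the group of automorphisms $\phi$ of $G$ with $\phi(g^{-1})g\in Z(G)\cap G'$ for all $g\in G$. $\mathrm{Aut}_{c'}(G)$ is embedded in $\mathrm{Aut}(\mathcal{D}(G))$ by $w\mapsto(e_g\# h\mapsto e_{w(g)}\# h)$. Elements of $\mathrm{Hom}(Z(G)\cap G',Z(G))$ correspond (after choosing an isomorphism of the abelian group $Z(G)\cap G'$ with its dual) to the automorphisms with $u=v=\mathrm{id}$, $r$ trivial and $p$ trivial on $\widehat{G}$; the semidirect product is taken with respect to conjugation in $\mathrm{Aut}(\mathcal{D}(G))$.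 *)

(* Defs.v *)
From HB Require Import structures.
From mathcomp Require Import all_boot all_order all_algebra all_fingroup.
From mathcomp Require Import all_solvable.
From mathcomp Require Import boolp.

Set Implicit Arguments.
Unset Strict Implicit.
Unset Printing Implicit Defensive.

Import GRing.Theory.
Local Open Scope ring_scope.

(* An element of D(G) is stored by its coordinates in the basis e_g # h:      *)
(* a (g, h) is the coefficient of e_g # h.                                    *)
Definition drinfeld (k : fieldType) (gT : finGroupType) : Type :=
  {ffun gT * gT -> k^o}.

HB.instance Definition _ (k : fieldType) (gT : finGroupType) :=
  Vector.copy (drinfeld k gT) {ffun gT * gT -> k^o}.

(* D(G) (x) D(G), with coordinates in the basis (e_g # h) (x) (e_g' # h').    *)
Definition drinfeld2 (k : fieldType) (gT : finGroupType) : Type :=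
  {ffun (gT * gT) * (gT * gT) -> k^o}.

HB.instance Definition _ (k : fieldType) (gT : finGroupType) :=
  Vector.copy (drinfeld2 k gT) {ffun (gT * gT) * (gT * gT) -> k^o}.

Section Drinfeld.
Variables (k : fieldType) (gT : finGroupType).
Local Notation D := (drinfeld k gT).
Local Notation D2 := (drinfeld2 k gT).
Implicit Types (a b c : D) (x y z g h : gT).

(* The element f # h, for f in k^G. *)
Definition dpure (f : {ffun gT -> k}) (h : gT) : D :=
  [ffun p => f p.1 *+ (p.2 == h)].

(* The element e_g of k^G; also g in kG, as both spaces are {ffun gT -> k}. *)
Definition fbasis (g : gT) : {ffun gT -> k} := [ffun x => (x == g)%:R].

Definition feps : {ffun gT -> k} := [ffun=> 1].

Definition dbasis (g h : gT) : D := dpure (fbasis g) h.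

Lemma dpureE f h x y : dpure f h (x, y) = f x *+ (y == h).
Proof. by rewrite ffunE. Qed.

Lemma dbasisE g h x y : dbasis g h (x, y) = ((x == g) && (y == h))%:R.
Proof. by rewrite dpureE ffunE -mulrnA mulnb. Qed.

Lemma dsumE a : a = \sum_p a p *: dbasis p.1 p.2.
Proof.
apply/ffunP=> -[x y]; rewrite sum_ffunE (bigD1 (x, y)) //= big1 => [|[u v] nuv].
  by rewrite addr0 !ffunE !eqxx /= /GRing.scale /= mulr1.
rewrite ffunE dbasisE -xpair_eqE eq_sym (negPf nuv).
by rewrite /GRing.scale /= mulr0.
Qed.

(* The multiplication is the bilinear extension of                            *)
(*   (e_g # g')(e_h # h') = delta_{g, g' h g'^-1} e_g # g' h',                *)
(* see dbasisM; here x ^ y = y^-1 * x * y.                                    *)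
Definition dmul a b : D :=
  [ffun p => \sum_y a (p.1, y) * b ((p.1 ^ y)%g, (y^-1 * p.2)%g)].

Definition dunit : D := dpure feps 1%g.

Fact dmulA : associative dmul.
Proof.
move=> a b c; apply/ffunP=> -[x z]; rewrite !ffunE /=.
transitivity (\sum_w \sum_y
   a (x, w) * (b ((x ^ w)%g, (w^-1 * y)%g) * c ((x ^ y)%g, (y^-1 * z)%g))).
  apply: eq_bigr => w _; rewrite ffunE big_distrr /=.
  rewrite (reindex_inj (mulgI w^-1%g)) /=; apply: eq_bigr => y _.
  by rewrite -conjgM mulKVg invMg invgK (mulgA _ _ z) mulgK.
rewrite exchange_big /=; apply: eq_bigr => y _.
by rewrite ffunE big_distrl /=; apply: eq_bigr => w _; rewrite mulrA.
Qed.

Fact dmul1 : left_id dunit dmul.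
Proof.
move=> a; apply/ffunP=> -[x z]; rewrite ffunE (bigD1 1%g) //= big1 => [|y ny].
  by rewrite addr0 dpureE ffunE eqxx mul1r conjg1 invg1 mul1g.
by rewrite dpureE (negPf ny) mul0r.
Qed.

Fact dmulr1 : right_id dunit dmul.
Proof.
move=> a; apply/ffunP=> -[x z]; rewrite ffunE (bigD1 z) //= big1 => [|y ny].
  by rewrite addr0 dpureE ffunE mulVg eqxx mulr1.
by rewrite dpureE -eq_mulVg1 (negPf ny) mulr0.
Qed.

Fact dmulDl : left_distributive dmul +%R.
Proof.
move=> a b c; apply/ffunP=> -[x z]; rewrite !ffunE -big_split /=.
by apply: eq_bigr => y _; rewrite ffunE mulrDl.
Qed.

Fact dmulDr : right_distributive dmul +%R.
Proof.
move=> a b c; apply/ffunP=> -[x z]; rewrite !ffunE -big_split /=.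
by apply: eq_bigr => y _; rewrite ffunE mulrDr.
Qed.

Fact dunit_neq0 : dunit != 0.
Proof.
apply/eqP=> /ffunP/(_ (1%g, 1%g)); rewrite dpureE !ffunE eqxx => /eqP.
by rewrite oner_eq0.
Qed.

HB.instance Definition _ := GRing.Zmodule_isNzRing.Build D
  dmulA dmul1 dmulr1 dmulDl dmulDr dunit_neq0.

Fact dscaleAl (s : k) a b : s *: (a * b) = (s *: a) * b.
Proof.
apply/ffunP=> p; rewrite !ffunE /GRing.scale /= big_distrr /=.
by apply: eq_bigr => y _; rewrite ffunE mulrA.
Qed.

HB.instance Definition _ := GRing.Lmodule_isLalgebra.Build k D dscaleAl.

Fact dscaleAr (s : k) a b : s *: (a * b) = a * (s *: b).
Proof.
apply/ffunP=> p; rewrite !ffunE /GRing.scale /= big_distrr /=.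
by apply: eq_bigr => y _; rewrite ffunE mulrCA.
Qed.

HB.instance Definition _ := GRing.Lalgebra_isAlgebra.Build k D dscaleAr.

Lemma dbasisM g g' h h' : dbasis g g' * dbasis h h' =
  if g == (g' * h * g'^-1)%g then dbasis g (g' * h')%g else 0.
Proof.
apply/ffunP=> -[x z]; rewrite ffunE (bigD1 g') //= big1 => [|y ny]; last first.
  by rewrite dbasisE (negPf ny) andbF mul0r.
rewrite addr0 !dbasisE eqxx andbT.
have ->: ((g'^-1 * z)%g == h') = (z == g' * h')%g.
  by rewrite -(inj_eq (mulgI g')) mulKVg.
have ->: ((x ^ g')%g == h) = (x == g' * h * g'^-1)%g.
  by rewrite -(inj_eq (mulgI g')) /conjg mulKVg -(inj_eq (mulIg g'^-1%g)) mulgK.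
rewrite -natrM mulnb; case: (eqVneq x g) => [->|ne] /=; last first.
  by case: ifP => _; rewrite ?dbasisE ?(negPf ne) ?ffunE.
by case: ifP => _ /=; rewrite ?dbasisE ?eqxx ?ffunE.
Qed.

Definition dtensor a b : D2 := [ffun p => a p.1 * b p.2].

(* Comultiplication of (k^G)^cop (x) kG, see comul_basis. *)
Definition comul a : D2 :=
  [ffun p => a ((p.2.1 * p.1.1)%g, p.1.2) *+ (p.1.2 == p.2.2)].

Lemma dtensorE a b p : dtensor a b p = a p.1 * b p.2.
Proof. by rewrite ffunE. Qed.

Lemma comulE a p :
  comul a p = a ((p.2.1 * p.1.1)%g, p.1.2) *+ (p.1.2 == p.2.2).
Proof. by rewrite ffunE. Qed.

Definition counit a : k := \sum_h a (1%g, h).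

Definition antipode a : D :=
  [ffun p => a (((p.1^-1) ^ p.2)%g, (p.2^-1)%g)].

Lemma comul_basis g h : comul (dbasis g h) =
  \sum_x dtensor (dbasis (x^-1 * g)%g h) (dbasis x h).
Proof.
apply/ffunP=> -[[x1 y1] [x2 y2]]; rewrite comulE sum_ffunE /=.
rewrite (bigD1 x2) //= big1 => [|x nx]; last first.
  by rewrite dtensorE /= !dbasisE [x2 == x]eq_sym (negPf nx) mulr0.
rewrite addr0 dtensorE /= !dbasisE eqxx /= -mulrnA -natrM !mulnb -andbA.
rewrite -(inj_eq (mulgI x2) x1) mulKVg -andbA; congr (_ && _)%:R.
by case: (y1 =P h) => //= ->; rewrite eq_sym.
Qed.

Lemma counit_basis g h : counit (dbasis g h) = (g == 1%g)%:R.
Proof.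
rewrite /counit (bigD1 h) //= big1 => [|x nx]; rewrite dbasisE.
  by rewrite addr0 eqxx andbT eq_sym.
by rewrite (negPf nx) andbF.
Qed.

Lemma antipode_basis g h :
  antipode (dbasis g h) = dbasis ((g^-1) ^ h)%g h^-1%g.
Proof.
apply/ffunP=> -[x y]; rewrite ffunE /= !dbasisE -[y^-1%g == _](inj_eq invg_inj).
rewrite invgK; case: (eqVneq y h^-1%g) => [->|]; rewrite ?andbF ?andbT //.
by rewrite -(inj_eq invg_inj) -conjVg invgK -(inj_eq (conjg_inj h)) conjgKV.
Qed.

Lemma antipode_left g h :
  \sum_x antipode (dbasis (x^-1 * g)%g h) * dbasis x h = counit (dbasis g h) *: 1.
Proof.
rewrite counit_basis; under eq_bigr => x _ do rewrite antipode_basis dbasisM.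
have cE x : (((x^-1 * g)^-1 ^ h)%g == (h^-1 * x * h^-1^-1)%g) = (g == 1%g).
  rewrite invgK -mulgA -/(x ^ h)%g (inj_eq (conjg_inj h)) -(inj_eq invg_inj).
  by rewrite invgK -[RHS](inj_eq (mulgI x^-1%g)) mulg1.
under eq_bigr => x _ do rewrite cE mulVg.
case: eqP => [->|_]; last by rewrite scale0r big1.
rewrite scale1r; apply/ffunP=> -[y z]; rewrite sum_ffunE dpureE ffunE.
rewrite (bigD1 (y ^ h^-1)%g) //= big1 => [|x nx]; rewrite dbasisE mulg1 invgK.
  by rewrite conjgKV eqxx addr0.
by rewrite -(inj_eq (conjg_inj h^-1%g)) conjgK eq_sym (negPf nx).
Qed.

Lemma antipode_right g h :
  \sum_x dbasis (x^-1 * g)%g h * antipode (dbasis x h) = counit (dbasis g h) *: 1.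
Proof.
rewrite counit_basis; under eq_bigr => x _ do rewrite antipode_basis dbasisM.
have cE x : ((x^-1 * g)%g == (h * (x^-1 ^ h) * h^-1)%g) = (g == 1%g).
  by rewrite /conjg mulKVg mulgK -[RHS](inj_eq (mulgI x^-1%g)) mulg1.
under eq_bigr => x _ do rewrite cE mulgV.
case: eqP => [->|_]; last by rewrite scale0r big1.
rewrite scale1r; apply/ffunP=> -[y z]; rewrite sum_ffunE dpureE ffunE.
rewrite (bigD1 y^-1%g) //= big1 => [|x nx]; rewrite dbasisE mulg1.
  by rewrite invgK eqxx addr0.
by rewrite -(inj_eq invg_inj) invgK eq_sym (negPf nx).
Qed.

(* f (x) f, as the linear extension of x (x) y |-> f x (x) f y. *)
Definition dtensor_map (f : D -> D) (t : D2) : D2 :=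
  \sum_p t p *: dtensor (f (dbasis p.1.1 p.1.2)) (f (dbasis p.2.1 p.2.2)).

Definition is_hopf_aut (f : 'End(D)) : Prop :=
  [/\ bijective f,
      f 1 = 1 /\ {morph f : a b / a * b},
      forall a, counit (f a) = counit a,
      forall a, comul (f a) = dtensor_map f (comul a)
    & forall a, f (antipode a) = antipode (f a)].

Lemma dtensor_mapE (f : {linear D -> D}) a b :
  dtensor_map f (dtensor a b) = dtensor (f a) (f b).
Proof.
rewrite [in RHS](dsumE a) [in RHS](dsumE b) !linear_sum /=.
apply/ffunP=> -[u v]; rewrite sum_ffunE ffunE /= !sum_ffunE big_distrlr /=.
rewrite pair_big /=; apply: eq_bigr => -[p q] _ /=.
by rewrite !linearZ /= !ffunE /GRing.scale /= mulrACA.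
Qed.

Lemma dtensor_map_comp (f g : {linear D -> D}) t :
  dtensor_map g (dtensor_map f t) = dtensor_map (g \o f) t.
Proof.
have lin : linear (dtensor_map g).
  move=> s t1 t2; rewrite /dtensor_map scaler_sumr -big_split /=.
  by apply: eq_bigr => p _; rewrite !ffunE scalerA scalerDl.
pose L : {linear D2 -> D2} :=
  HB.pack (dtensor_map g) (GRing.isLinear.Build _ _ _ _ _ lin).
rewrite -[dtensor_map g _]/(L _) linear_sum; apply: eq_bigr => p _.
by rewrite linearZ /= dtensor_mapE.
Qed.

Lemma dtensor_map_id t : dtensor_map id t = t.
Proof.
apply/ffunP=> -[[u1 v1] [u2 v2]]; rewrite sum_ffunE.
rewrite (bigD1 (u1, v1, (u2, v2))) //= big1 => [|[[x1 y1] [x2 y2]] ne].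
  by rewrite addr0 !ffunE !eqxx /= /GRing.scale /= !mulr1.
rewrite ffunE dtensorE /= !dbasisE -natrM mulnb -!xpair_eqE /=.
by rewrite eq_sym (negPf ne) /GRing.scale /= mulr0.
Qed.

(* The group Aut(D(G)).  As for {perm T}, the product is composition in       *)
(* diagrammatic order, (psi * phi) a = phi (psi a); the map sending w   *)
(* to (e_g # h |-> e_(w g) # h) is then multiplicative on {perm gT}.          *)
Record hopfAut := HopfAut { hval :> 'End(D); _ : `[< is_hopf_aut hval >] }.

HB.instance Definition _ := [isSub for hval].
HB.instance Definition _ := [Choice of hopfAut by <:].

Implicit Types psi phi : hopfAut.

Lemma hopfAutP psi : is_hopf_aut psi.
Proof. by apply/asboolP; case: psi. Qed.

Lemma hopfAut_eqP psi phi : psi =1 phi <-> psi = phi.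
Proof. by split=> [e|-> //]; apply/val_inj/lfunP. Qed.

Fact hopf_one_subproof : `[< is_hopf_aut \1%VF >].
Proof.
have i : (\1%VF : 'End(D)) =1 id by move=> a; rewrite id_lfunE.
apply/asboolP; split=> [||a|a|a]; rewrite ?i //.
- by exists id => a; rewrite i.
- by split=> [|a b]; rewrite ?i.
by rewrite -[LHS]dtensor_map_id; apply: eq_bigr => p _; rewrite !i.
Qed.

Fact hopf_mul_subproof psi phi : `[< is_hopf_aut (phi \o psi)%VF >].
Proof.
have i a : (phi \o psi)%VF a = phi (psi a) by rewrite comp_lfunE.
have [b1 [u1 m1] e1 d1 s1] := hopfAutP psi.
have [b2 [u2 m2] e2 d2 s2] := hopfAutP phi.
apply/asboolP; split=> [||a|a|a].
- exact: (eq_bij (bij_comp b2 b1)).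
- by split=> [|a b]; rewrite !i ?u1 ?u2 // m1 m2.
- by rewrite i e2.
- rewrite i d2 d1 dtensor_map_comp; apply: eq_bigr => p _.
  by rewrite !i.
by rewrite !i s1 s2.
Qed.

Fact hopf_inv_subproof psi : `[< is_hopf_aut (psi^-1)%VF >].
Proof.
have [b1 [u1 m1] e1 d1 s1] := hopfAutP psi.
have k0 : lker psi == 0%VS by apply/lker0P/bij_inj.
have K : cancel psi (psi^-1)%VF := lker0_lfunK k0.
have K' : cancel (psi^-1)%VF psi.
  by case: b1 => f fK Kf a; rewrite -[a]Kf K.
have I := can_inj K.
apply/asboolP; split=> [||a|a|a].
- by exists psi.
- by split=> [|a b]; apply: I; rewrite ?m1 !K'.
- by rewrite -e1 K'.
- rewrite -[in RHS](K' a) d1 dtensor_map_comp -[LHS]dtensor_map_id.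
  by apply: eq_bigr => p _; rewrite /= !K.
by apply: I; rewrite s1 !K'.
Qed.

Definition hopf_one := HopfAut hopf_one_subproof.
Definition hopf_mul psi phi := HopfAut (hopf_mul_subproof psi phi).
Definition hopf_inv psi := HopfAut (hopf_inv_subproof psi).

Fact hopf_mulA : associative hopf_mul.
Proof. by move=> f g h; apply/hopfAut_eqP=> a; rewrite /= !comp_lfunE. Qed.
Fact hopf_mul1 : left_id hopf_one hopf_mul.
Proof. by move=> f; apply/hopfAut_eqP=> a; rewrite /= comp_lfunE id_lfunE. Qed.
Fact hopf_mulr1 : right_id hopf_one hopf_mul.
Proof. by move=> f; apply/hopfAut_eqP=> a; rewrite /= comp_lfunE id_lfunE. Qed.
Fact hopf_mulV : left_inverse hopf_one hopf_inv hopf_mul.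
Proof.
move=> f; apply/hopfAut_eqP=> a; rewrite /= comp_lfunE id_lfunE.
have [[g fK Kf] _ _ _ _] := hopfAutP f.
by rewrite -{1}[a]Kf lker0_lfunK ?Kf //; apply/lker0P/(can_inj fK).
Qed.
Fact hopf_mulrV : right_inverse hopf_one hopf_inv hopf_mul.
Proof.
move=> f; apply/hopfAut_eqP=> a; rewrite /= comp_lfunE id_lfunE.
have [b _ _ _ _] := hopfAutP f.
by rewrite lker0_lfunK //; apply/lker0P/bij_inj.
Qed.

HB.instance Definition _ := isGroup.Build hopfAut
  hopf_mulA hopf_mul1 hopf_mulr1 hopf_mulV hopf_mulrV.

Lemma hopfAutM psi phi a : (psi * phi)%g a = phi (psi a).
Proof. exact: comp_lfunE. Qed.

Lemma hopfAut1 a : (1%g : hopfAut) a = a.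
Proof. exact: id_lfunE. Qed.

(* The values of chi are automatically nonzero, so chi is in Hom(G, k^x). *)
Definition is_char (chi : {ffun gT -> k}) : Prop :=
  chi 1%g = 1 /\ forall x y, chi (x * y)%g = chi x * chi y.

Definition grouplike a : Prop := counit a = 1 /\ comul a = dtensor a a.

Lemma grouplikeP a :
  grouplike a <-> exists chi h, is_char chi /\ a = dpure chi h.
Proof.
split=> [[e1 /ffunP d]|[chi [h [[c1 cM] ->]]]]; last first.
  split; first rewrite /counit (bigD1 h) //= big1 => [|x nx].
  - by rewrite dpureE eqxx addr0.
  - by rewrite dpureE (negPf nx).
  apply/ffunP=> -[[x1 y1] [x2 y2]]; rewrite comulE dtensorE !dpureE /= cM.
  case: (eqVneq y1 h) => [->|n1]; last by rewrite mul0r mul0rn.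
  by rewrite mulrC mulrnAr eq_sym.
have dE x y u v : a (x, u) * a (y, v) = a ((y * x)%g, u) *+ (u == v).
  by have := d ((x, u), (y, v)); rewrite !ffunE /= => <-.
have [h nh] : exists h, a (1%g, h) != 0.
  apply/existsP; apply: contraTT isT => /existsPn n.
  have := e1; rewrite /counit big1 => [/eqP|h _].
    by rewrite eq_sym oner_eq0.
  by apply/eqP; have := n h; rewrite negbK.
have a1 : a (1%g, h) = 1.
  have := dE 1%g 1%g h h; rewrite mulg1 eqxx mulr1n => E.
  by apply: (mulfI nh); rewrite E mulr1.
exists [ffun x => a (x, h)], h; split.
  split=> [|x y]; first by rewrite ffunE.
  by rewrite !ffunE mulrC dE eqxx.
apply/ffunP=> -[x y]; rewrite dpureE ffunE.
case: eqP => [-> //|ne]; have := dE 1%g x h y.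
by rewrite a1 mul1r mulg1 => ->; case: eqP ne => // ->.
Qed.

(* The group of group-like elements, under the product of D(G). *)
Record gamma := Gamma { gval : D; _ : `[< grouplike gval >] }.

HB.instance Definition _ := [isSub for gval].
HB.instance Definition _ := [Choice of gamma by <:].

Lemma gammaP (x : gamma) : grouplike (gval x).
Proof. by apply/asboolP; case: x. Qed.

Lemma dpureM chi chi' h h' : is_char chi' ->
  dpure chi h * dpure chi' h' = dpure [ffun x => chi x * chi' x] (h * h')%g.
Proof.
move=> [c1 cM]; apply/ffunP=> -[x z]; rewrite ffunE dpureE ffunE /=.
rewrite (bigD1 h) //= big1 => [|y ny]; last by rewrite dpureE (negPf ny) mul0r.
rewrite addr0 !dpureE eqxx -(inj_eq (mulgI h) (_ * _)%g) mulKVg -mulrnAr.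
congr (_ * (_ *+ _)); rewrite /conjg !cM mulrCA -cM mulVg c1.
by rewrite mulr1.
Qed.

Fact gamma_one_subproof : `[< grouplike 1 >].
Proof.
apply/asboolP/grouplikeP; exists feps, 1%g; split=> //.
by split=> [|x y]; rewrite !ffunE ?mulr1.
Qed.

Fact gamma_mul_subproof (x y : gamma) : `[< grouplike (gval x * gval y) >].
Proof.
have /grouplikeP[c [g [[c1 cM] ->]]] := gammaP x.
have /grouplikeP[d [h [[d1 dM] ->]]] := gammaP y.
apply/asboolP/grouplikeP; exists [ffun x => c x * d x], (g * h)%g.
split; last by rewrite dpureM.
by split=> [|u v]; rewrite !ffunE ?c1 ?d1 ?mulr1 // cM dM mulrACA.
Qed.

Lemma grouplike_antipode a : grouplike a ->
  [/\ grouplike (antipode a), antipode a * a = 1 & a * antipode a = 1].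
Proof.
move=> /grouplikeP[c [h [[c1 cM] ->]]].
have cV x : c x^-1%g * c x = 1 by rewrite -cM mulVg.
have cJ x y : c (x ^ y)%g = c x by rewrite /conjg !cM mulrCA cV mulr1.
have SE : antipode (dpure c h) = dpure [ffun x => c x^-1%g] h^-1%g.
  apply/ffunP=> -[x y]; rewrite ffunE !dpureE ffunE /= cJ.
  by rewrite -(inj_eq invg_inj) invgK.
have cc : is_char [ffun x => c x^-1%g].
  by split=> [|x y]; rewrite !ffunE ?invg1 // invMg cM mulrC.
have oneE (f : {ffun gT -> k}) : (forall x, f x = 1) -> dpure f 1%g = 1.
  by move=> f1; congr (dpure _ _); apply/ffunP=> x; rewrite f1 ffunE.
rewrite SE; split.
- by apply/grouplikeP; exists [ffun x => c x^-1%g], h^-1%g.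
- by rewrite dpureM // mulVg oneE // => x; rewrite !ffunE cV.
by rewrite dpureM // mulgV oneE // => x; rewrite !ffunE mulrC cV.
Qed.

Fact gamma_inv_subproof (x : gamma) : `[< grouplike (antipode (gval x)) >].
Proof. by apply/asboolP; have [] := grouplike_antipode (gammaP x). Qed.

Definition gamma_one := Gamma gamma_one_subproof.
Definition gamma_mul (x y : gamma) := Gamma (gamma_mul_subproof x y).
Definition gamma_inv (x : gamma) := Gamma (gamma_inv_subproof x).

Fact gamma_mulA : associative gamma_mul.
Proof. by move=> x y z; apply: val_inj; rewrite /= mulrA. Qed.
Fact gamma_mul1 : left_id gamma_one gamma_mul.
Proof. by move=> x; apply: val_inj; rewrite /= mul1r. Qed.
Fact gamma_mulr1 : right_id gamma_one gamma_mul.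
Proof. by move=> x; apply: val_inj; rewrite /= mulr1. Qed.
Fact gamma_mulV : left_inverse gamma_one gamma_inv gamma_mul.
Proof.
by move=> x; apply: val_inj; have [_ ? _] := grouplike_antipode (gammaP x).
Qed.
Fact gamma_mulrV : right_inverse gamma_one gamma_inv gamma_mul.
Proof.
by move=> x; apply: val_inj; have [_ _ ?] := grouplike_antipode (gammaP x).
Qed.

HB.instance Definition _ := isGroup.Build gamma
  gamma_mulA gamma_mul1 gamma_mulr1 gamma_mulV gamma_mulrV.

Fact res_subproof psi (x : gamma) : `[< grouplike (psi (gval x)) >].
Proof.
have [_ _ e d _] := hopfAutP psi; have [ex dx] := gammaP x.
by apply/asboolP; split; rewrite ?e // d dx dtensor_mapE.
Qed.

Definition res psi (x : gamma) : gamma := Gamma (res_subproof psi x).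

Fact res_is_multiplicative psi : {morph res psi : x y / (x * y)%g}.
Proof.
by move=> x y; apply: val_inj; have [_ [_ m] _ _ _] := hopfAutP psi; apply: m.
Qed.

HB.instance Definition _ psi :=
  isMultiplicative.Build gamma gamma (res psi) (res_is_multiplicative psi).

Lemma resM psi phi : res (psi * phi)%g =1 res phi \o res psi.
Proof. by move=> x; apply: val_inj; apply: hopfAutM. Qed.

Lemma res_bij psi : bijective (res psi).
Proof.
have r1 (x : gamma) : res (1%g : hopfAut) x = x by apply: val_inj; apply: hopfAut1.
by exists (res psi^-1%g) => x;
  [have := resM psi psi^-1%g x | have := resM psi^-1%g psi x];
  rewrite ?mulgV ?mulVg r1 => {2}->.
Qed.

Definition res_ker psi : Prop := res psi =1 id.

(* id (x) counit and ev_1 (x) id *)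
Definition proj_fun a : {ffun gT -> k} := [ffun g => \sum_h a (g, h)].
Definition proj_grp a : {ffun gT -> k} := [ffun h => a (1%g, h)].

Definition comp_u psi (f : {ffun gT -> k}) := proj_fun (psi (dpure f 1%g)).
Definition comp_p psi (f : {ffun gT -> k}) := proj_grp (psi (dpure f 1%g)).
Definition comp_r psi (g : gT) := proj_fun (psi (dpure feps g)).
Definition comp_v psi (g : gT) := proj_grp (psi (dpure feps g)).

Definition u_id psi : Prop := forall f, comp_u psi f = f.
Definition v_id psi : Prop := forall g, comp_v psi g = fbasis g.
Definition r_trivial psi : Prop := forall g, comp_r psi g = feps.
Definition p_trivial_on_chars psi : Prop :=
  forall chi, is_char chi -> comp_p psi chi = fbasis 1%g.

Definition Lambda_c psi : Prop := v_id psi /\ r_trivial psi.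

(* The automorphisms that correspond to elements of Hom(Z(G) :&: G', Z(G)). *)
Definition is_hom_aut psi : Prop :=
  [/\ u_id psi, v_id psi, r_trivial psi & p_trivial_on_chars psi].

End Drinfeld.

(* the join of the library's groupType and finType structures *)
HB.instance Definition _ (aT : finType) (rT : finGroupType) :=
  Finite.on {ffun aT -> rT}.

Section FiniteSide.
Variable gT : finGroupType.
Local Open Scope group_scope.

(* Z(G) :&: G' for G the whole group type *)
Definition ZD : {group gT} := ('Z([set: gT]) :&: [set: gT]^`(1))%G.

Definition Aut_c' : {set {perm gT}} :=
  [set w in Aut [set: gT] | [forall g, w g^-1 * g \in ZD]].

Lemma Aut_c'E w : (w \in Aut_c') =
  (w \in Aut [set: gT]) && [forall g, w g^-1 * g \in ZD].
Proof. by rewrite in_set. Qed.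

Lemma Aut_c'_morph w : w \in Aut_c' -> {morph w : x y / x * y}.
Proof.
rewrite Aut_c'E => /andP[Aw _] x y.
by apply: (morphicP (Aut_morphic Aw)); rewrite in_setT.
Qed.

Fact Aut_c'_group_set : group_set Aut_c'.
Proof.
apply/group_setP; split.
  rewrite Aut_c'E group1; apply/forallP=> g.
  by rewrite perm1 mulVg group1.
move=> v w Hv; have vM := Aut_c'_morph Hv; move: Hv; rewrite !Aut_c'E.
case/andP=> Av /forallP zv /andP[Aw /forallP zw]; rewrite groupM //=.
apply/forallP=> g; rewrite permM.
have v1 : v 1 = 1 by apply: (mulgI (v 1)); rewrite -vM !mulg1.
have vV : v g^-1 = (v g)^-1.
  by apply: (mulgI (v g)); rewrite mulgV -vM mulgV.
have := groupM (zw (v g)) (zv g).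
by rewrite vV mulgA mulgK.
Qed.

Canonical Aut_c'_group := Group Aut_c'_group_set.

(* Hom(A, Z(G)) with pointwise product, as a subgroup of all maps A -> G. *)
Definition homZ (A : {group gT}) : {set {ffun subg_of A -> gT}} :=
  [set f : {ffun subg_of A -> gT} |
     morphic [set: subg_of A] f & [forall x, f x \in 'Z([set: gT])]].

Fact homZ_group_set (A : {group gT}) : group_set (homZ A).
Proof.
apply/group_setP; split.
  rewrite inE; apply/andP; split; last first.
    by apply/forallP=> x; rewrite ffunE group1.
  by apply/morphicP=> x y _ _; rewrite !ffunE mulg1.
move=> f g; rewrite !inE => /andP[/morphicP mf /forallP zf].
move=> /andP[/morphicP mg /forallP zg]; apply/andP; split; last first.
  by apply/forallP=> x; rewrite ffunE groupM.
apply/morphicP=> x y xA yA; rewrite !ffunE mf // mg //.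
have /centerP[_ cx] := zg x.
by rewrite !mulgA; congr (_ * _); rewrite -!mulgA cx ?inE.
Qed.

Canonical homZ_group A := Group (homZ_group_set A).

End FiniteSide.

(* Main.v *)
(* If psi fixes every 1 # g, it is determined by M(g; x, t), the coefficients  *)
(* of psi (e_g # 1); put U(g, x) = sum_t M(g; x, t) and P(g, t) = M(g; 1, t),  *)
(* the matrices of u and p.  U is invertible since psi^-1 fixes the 1 # g too, *)
(* so cocommutativity of M = U * P = P * U makes P a class function of g.      *)
(* As psi commutes with conjugation, the image of p is central; then u is      *)
(* multiplicative, so u (e_g) = e_(w g) for a central automorphism w, and P is *)
(* supported on Z(G), because distinct conjugates of g would carry equal and   *)
(* orthogonal idempotents p (e_g).  If psi also fixes the chi # 1, characters  *)
(* separating G / G' push w (g) g^-1 and the support of P into A = Z(G) n G'.  *)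
(* Fourier inversion on A for a nondegenerate bicharacter beta turns p into a  *)
(* homomorphism A -> Z(G).  The elements of Aut_c' fix A pointwise, so they    *)
(* commute with the automorphisms coming from Hom(A, Z(G)), and the            *)
(* semidirect product is in fact direct.                                       *)
From HB Require Import structures.
Require Import Defs.
From mathcomp Require Import all_boot all_order all_algebra all_fingroup.
From mathcomp Require Import all_solvable separable cyclotomic.
From mathcomp Require Import boolp.

Set Implicit Arguments.
Unset Strict Implicit.
Unset Printing Implicit Defensive.

(** Write A for Z(G) :&: G'. An automorphism in the kernel fixes every 1 # g, so it is known from
    its values on k^G, that is from u and p. Comultiplicativity expresses psi (e_g # 1) as the
    convolution of u and p in either order ([M_UP], [M_PU]). Since u is invertible, p is a class
    function, hence p has central image and central support ([P_centerr], [P_centerl]). Then u is an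
    algebra map, so it permutes the e_g through a central automorphism of G ([U_perm]). Fixing the
    chi # 1 as well confines the displacement of this automorphism and the support of p to G',
    because characters separate G / G' ([res_ker_perm], [P_ZD]).

    What is left of p is a Hopf map from k^A to k Z(G). A nondegenerate bicharacter beta identifies
    A with its dual, so k^A becomes kA and p becomes a homomorphism F from A to Z(G)
    ([res_ker_hom]). Conversely, each pair (w, F) gives an automorphism in the kernel, by explicit
    formulas: [aut_map_hopf] for w, [hom_map_hopf] for F. The two families commute, because w fixes
    G' pointwise ([aut_map_hom_map]). Thus [Phi] is a morphism from the semidirect product by the
    trivial action, injective by [Phi_inj] and onto the kernel by [Phi_surj].

    The kernel is trivial exactly when A is, since the inclusion of A in Z(G) is one of the
    homomorphisms F ([res_ker_trivial]). If Z(G) lies in G', characters are blind to central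
    elements, so the whole of Lambda_c lies in the kernel ([fixes_grp_res_ker]). Conversely, the
    same construction carried out over Z(G) in place of A gives an element of Lambda_c that moves
    every character nontrivial on Z(G) ([center_sub_der]). *)

(** * Nondegenerate symmetric bicharacters on finite abelian groups *)

Section Bicharacters.

Import GRing.Theory.
Local Open Scope ring_scope.

Variable k : closedFieldType.
Hypothesis chark : [pchar k] =i pred0.

Lemma prim_root_exists n : (0 < n)%N -> exists z : k, n.-primitive_root z.
Proof.
move=> n_gt0; have [rs Ers] := closed_field_poly_normal ('X^n - 1 : {poly k}).
rewrite (monicP _) ?monicXnsubC // scale1r in Ers.
have rs1 : all n.-unity_root rs by apply/allP=> z; rewrite -root_prod_XsubC -Ers.
have sz_rs : (n < (size rs).+1)%N.
  by rewrite -(size_prod_XsubC rs id) -Ers size_XnsubC.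
have [|z] := hasP (has_prim_root n_gt0 rs1 _ sz_rs); last by exists z.
rewrite -separable_prod_XsubC -Ers separable_Xn_sub_1 //.
by move/pcharf0P: chark => ->; rewrite -lt0n.
Qed.

Section Finite.
Variable aT : finGroupType.
Implicit Types H K L : {group aT}.

(* The clause on beta 1 x rules out the value 0. *)
Definition nondeg_bichar (H : {set aT}) (beta : aT -> aT -> k) :=
  [/\ {in H &, forall x y, beta x y = beta y x},
      {in H, forall x, beta 1%g x = 1},
      {in H & &, forall x y z, beta (x * y)%g z = beta x z * beta y z}
    & {in H, forall x, (forall y, y \in H -> beta x y = 1) -> x = 1%g}].

(** With z a primitive root of unity of order #[x] and d a discrete logarithm to base x, take z ^ (d
    y * d t); pairing with the generator x already detects y. *)
Lemma nondeg_bichar_cycle x : exists beta, nondeg_bichar <[x]>%g beta.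
Proof.
have [z prim_z] := prim_root_exists (order_gt0 x).
have /fin_all_exists[d dP] y : exists i, y \in <[x]>%g -> (x ^+ i)%g = y.
  by case: (boolP (y \in <[x]>%g)) => [/cycleP[i ->]|_]; [exists i | exists 0%N].
have dM y y' : y \in <[x]>%g -> y' \in <[x]>%g ->
    (d (y * y')%g = d y + d y' %[mod #[x]%g])%N.
  by move=> xy xy'; apply/eqP; rewrite -eq_expg_mod_order expgD !dP ?groupM.
exists (fun y t => z ^+ (d y * d t)); split=> [y t _ _|y _|y y' t xy xy' _|y xy y1].
- by rewrite mulnC.
- apply/eqP; rewrite -(expr0 z) (eq_prim_root_expr prim_z) -modnMml.
  have ->: (d 1%g = 0 %[mod #[x]%g])%N; last by rewrite mod0n mul0n mod0n.
  by apply/eqP; rewrite -eq_expg_mod_order dP ?group1.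
- rewrite -exprD -mulnDl; apply/eqP; rewrite (eq_prim_root_expr prim_z).
  by rewrite -modnMml dM // modnMml.
have dx : (d x = 1 %[mod #[x]%g])%N.
  by apply/eqP; rewrite -eq_expg_mod_order dP ?cycle_id.
have /eqP := y1 x (cycle_id x); rewrite -(expr0 z) (eq_prim_root_expr prim_z).
rewrite -modnMmr dx modnMmr muln1 -eq_expg_mod_order => /eqP.
by rewrite dP.
Qed.

Lemma nondeg_bichar_dprod (H K L : {group aT}) bK bL : (K \x L = H)%g ->
  nondeg_bichar K bK -> nondeg_bichar L bL -> exists beta, nondeg_bichar H beta.
Proof.
move=> defH [sK oK mK nK] [sL oL mL nL].
have /fin_all_exists[p pP] x : exists u : aT * aT,
    x \in H -> [/\ u.1 \in K, u.2 \in L & x = (u.1 * u.2)%g].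
  case: (boolP (x \in H)) => [Hx|_]; last by exists (x, x).
  by have [y [z [? ? ? _]]] := mem_dprod defH Hx; exists (y, z).
have pU x y z : y \in K -> z \in L -> x = (y * z)%g -> p x = (y, z).
  move=> Ky Lz ->; have /dprodP[_ defKL _ _] := defH.
  have Hx : (y * z)%g \in H by rewrite -defKL mem_mulg.
  have [y' [z' [_ _ _ U]]] := mem_dprod defH Hx.
  have [Kp Lp e] := pP _ Hx; have [e1 e2] := U _ _ Kp Lp e.
  have [e3 e4] := U _ _ Ky Lz erefl.
  by rewrite [p _]surjective_pairing e1 e2 e3 e4.
have pM x y : x \in H -> y \in H ->
    p (x * y)%g = ((p x).1 * (p y).1, (p x).2 * (p y).2)%g.
  move=> Hx Hy; have [Kx Lx ex] := pP _ Hx; have [Ky Ly ey] := pP _ Hy.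
  apply: pU; rewrite ?groupM // {1}ex {1}ey -!mulgA; congr (_ * _)%g.
  rewrite !mulgA; congr (_ * _)%g; have /dprodP[_ _ /centsP c _] := defH.
  by rewrite c.
have sKH : {subset K <= H}.
  by move=> y Ky; have /dprodP[_ <- _ _] := defH; rewrite -[y]mulg1 mem_mulg.
have sLH : {subset L <= H}.
  by move=> y Ly; have /dprodP[_ <- _ _] := defH; rewrite -[y]mul1g mem_mulg.
exists (fun x y => bK (p x).1 (p y).1 * bL (p x).2 (p y).2).
split=> [x y Hx Hy|x Hx|x y z Hx Hy Hz|x Hx x1].
- by have [? ? _] := pP x Hx; have [? ? _] := pP y Hy; rewrite sK // sL.
- have [? ? _] := pP x Hx.
  by rewrite (pU 1%g 1%g 1%g) ?mulg1 ?group1 //= oK // oL // mulr1.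
- have [? ? _] := pP x Hx; have [? ? _] := pP y Hy; have [? ? _] := pP z Hz.
  by rewrite pM //= mK // mL // mulrACA.
have [Kx Lx ex] := pP x Hx.
have p1 : (p x).1 = 1%g.
  apply: nK Kx _ => y My; have := x1 y (sKH y My).
  by rewrite (pU y y 1%g) ?mulg1 ?group1 //= (sL _ 1%g) ?group1 // oL // mulr1.
have p2 : (p x).2 = 1%g.
  apply: nL Lx _ => y My; have := x1 y (sLH y My).
  by rewrite (pU y 1%g y) ?mul1g ?group1 //= (sK _ 1%g) ?group1 // oK // mul1r.
by rewrite ex p1 p2 mulg1.
Qed.

Lemma nondeg_bichar_exists H : abelian H -> exists beta, nondeg_bichar H beta.
Proof.
move=> abH; have [b defH _] := abelian_structure abH.
elim: b H defH {abH} => [|x b IHb] H.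
  rewrite big_nil => <-; exists (fun _ _ => 1).
  by split=> // [x y z _ _ _|x /set1P //]; rewrite mulr1.
rewrite big_cons => defH; have /dprodP[[K L _ defL] _ _ _] := defH.
have [bL HL] := IHb _ defL; have [bK HK] := nondeg_bichar_cycle x.
by rewrite defL in defH; apply: nondeg_bichar_dprod defH HK HL.
Qed.

End Finite.
End Bicharacters.

(** * Idempotents in a field *)

Section Idempotents.

Import GRing.Theory.
Local Open Scope ring_scope.

Lemma natr_bool_inj (R : nzRingType) : injective (fun b : bool => b%:R : R).
Proof. by case=> -[] // /eqP; rewrite ?oner_eq0 // eq_sym oner_eq0. Qed.

(** Pointwise orthogonal idempotents with sum 1 single out one index. This is how group elements are
    extracted from coefficient matrices. *)
Lemma orth_idem_delta (k : fieldType) (I : finType) (q : I -> k) :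
  (forall i j, q i * q j = q i *+ (i == j)) -> \sum_i q i = 1 ->
  exists i, forall j, q j = (j == i)%:R.
Proof.
move=> qM q1; have [i ni] : exists i, q i != 0.
  apply/existsP; apply: contra_eqT q1 => /existsPn n0.
  by rewrite big1 ?(eq_sym 0) ?oner_eq0 // => i _; apply/eqP; have := n0 i; rewrite negbK.
exists i => j; case: eqP => [->|/eqP nj]; apply: (mulfI ni); rewrite qM.
  by rewrite eqxx mulr1.
by rewrite eq_sym (negPf nj) mulr0.
Qed.

End Idempotents.

(** * Recognizing Hopf automorphisms on the basis *)

Section HopfLemmas.

Import GRing.Theory.
Local Open Scope ring_scope.

Variables (k : fieldType) (gT : finGroupType).
Local Notation D := (drinfeld k gT).

Lemma dtensor_map_sum (f : D -> D) (I : finType) (F : I -> drinfeld2 k gT) :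
  dtensor_map f (\sum_i F i) = \sum_i dtensor_map f (F i).
Proof.
rewrite /dtensor_map exchange_big; apply: eq_bigr => p _ /=.
by rewrite sum_ffunE scaler_suml.
Qed.

Lemma dtensor_mapZ (f : D -> D) s t : dtensor_map f (s *: t) = s *: dtensor_map f t.
Proof.
by rewrite /dtensor_map scaler_sumr; apply: eq_bigr => p _; rewrite ffunE scalerA.
Qed.

Lemma comul_sum (I : finType) (F : I -> D) : comul (\sum_i F i) = \sum_i comul (F i).
Proof.
apply/ffunP=> p; rewrite comulE !sum_ffunE -sumrMnl; apply: eq_bigr => i _.
by rewrite comulE.
Qed.

Lemma comulZ s (a : D) : comul (s *: a) = s *: comul a.
Proof. by apply/ffunP=> p; rewrite !ffunE /GRing.scale /= mulrnAr. Qed.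

Lemma comul_dtensor_map_basis (f : {linear D -> D}) :
  (forall g h, comul (f (dbasis k g h)) =
     \sum_x dtensor (f (dbasis k (x^-1 * g)%g h)) (f (dbasis k x h))) ->
  forall a, comul (f a) = dtensor_map f (comul a).
Proof.
move=> fb a; rewrite (dsumE a) linear_sum !comul_sum dtensor_map_sum.
apply: eq_bigr => -[g h] _ /=; rewrite linearZ !comulZ dtensor_mapZ fb comul_basis.
by rewrite dtensor_map_sum; under [in RHS]eq_bigr do rewrite dtensor_mapE.
Qed.

(* hopf_of f is 1 when f is not a Hopf automorphism. *)
Definition hopf_of (f : D -> D) : hopfAut k gT :=
  insubd (1%g : hopfAut k gT) (linfun f).

Lemma hopf_ofE (f : {linear D -> D}) :
  bijective f -> f 1 = 1 -> {morph f : a b / a * b} ->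
  (forall a, counit (f a) = counit a) ->
  (forall g h, comul (f (dbasis k g h)) =
     \sum_x dtensor (f (dbasis k (x^-1 * g)%g h)) (f (dbasis k x h))) ->
  (forall a, f (antipode a) = antipode (f a)) ->
  hopf_of f =1 f.
Proof.
move=> fbij f1 fM fe fd fS a.
rewrite /hopf_of val_insubd asboolT; first by rewrite lfunE.
have fE : linfun f =1 f by apply: lfunE.
split=> [||b|b|b]; rewrite ?fE //.
- exact: (eq_bij fbij).
- by split=> // b c; rewrite !fE fM.
- rewrite (comul_dtensor_map_basis fd); apply: eq_bigr => p _.
  by rewrite !fE.
Qed.

End HopfLemmas.

(** * Fourier analysis on a central subgroup A, and the automorphism attached to F : A -> Z(G) *)

Section Fourier.

Import GRing.Theory.
Local Open Scope ring_scope.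

Variables (k : closedFieldType) (gT : finGroupType).
Hypothesis chark : [pchar k] =i pred0.
Variables (A : {group gT}) (beta : gT -> gT -> k).
Hypothesis betaP : nondeg_bichar A beta.

Lemma bicharC x y : x \in A -> y \in A -> beta x y = beta y x.
Proof. by case: betaP => H _ _ _; apply: H. Qed.

Lemma bichar1l x : x \in A -> beta 1%g x = 1.
Proof. by case: betaP => _ H _ _; apply: H. Qed.

Lemma bicharMl x y z : x \in A -> y \in A -> z \in A ->
  beta (x * y)%g z = beta x z * beta y z.
Proof. by case: betaP => _ _ H _; apply: H. Qed.

Lemma bicharMr x y z : x \in A -> y \in A -> z \in A ->
  beta x (y * z)%g = beta x y * beta x z.
Proof.
by move=> Ax Ay Az; rewrite bicharC ?groupM // bicharMl // !(bicharC Ax).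
Qed.

Lemma bicharVr x y : x \in A -> y \in A -> beta x y^-1%g = beta x^-1%g y.
Proof.
move=> Ax Ay; rewrite -[LHS]mulr1 -(bichar1l Ay) -(mulgV x).
rewrite bicharMl ?groupV // mulrA -bicharMr ?groupV // mulVg.
by rewrite bicharC ?group1 // bichar1l // mul1r.
Qed.

Lemma cardA_neq0 : #|A|%:R != 0 :> k.
Proof. by move/pcharf0P: chark => ->; rewrite -lt0n cardG_gt0. Qed.

Lemma bichar_sum x : x \in A -> \sum_(a in A) beta a x = #|A|%:R * (x == 1%g)%:R.
Proof.
move=> Ax; case: eqP => [->|nx].
  rewrite mulr1 -sumr_const; apply: eq_bigr => a Aa.
  by rewrite bicharC ?group1 // bichar1l.
rewrite mulr0; apply/eqP; apply: contra_notT nx => S0.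
case: betaP => _ _ _; apply=> // y Ay; rewrite bicharC //.
apply: (mulIf S0); rewrite mul1r [RHS](reindex_inj (mulgI y)) /= big_distrr /=.
by apply: eq_big => [a|a Aa]; rewrite ?groupMl // bicharMl.
Qed.

(** The coefficient of the character beta b in the expansion of e_y on A, see [fourier_invl]. *)
Definition fourier_coef (b y : gT) : k := #|A|%:R^-1 * beta b y^-1%g.
Local Notation E := fourier_coef.

Lemma fourier_sum_r b : b \in A -> \sum_(y in A) E b y = (b == 1%g)%:R.
Proof.
move=> Ab; rewrite -big_distrr (reindex_inj invg_inj) /=.
under eq_bigl do rewrite groupV.
under eq_bigr => y Ay do rewrite invgK bicharC //.
by rewrite bichar_sum // mulKf ?cardA_neq0.
Qed.

Lemma fourier_sum_l y : y \in A -> \sum_(b in A) E b y = (y == 1%g)%:R.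
Proof.
move=> Ay; rewrite -big_distrr /= bichar_sum ?groupV // mulKf ?cardA_neq0 //.
by rewrite invg_eq1.
Qed.

Lemma fourierMl b c y : b \in A -> c \in A -> y \in A ->
  E (b * c) y = beta b y^-1%g * E c y.
Proof. by move=> *; rewrite /E bicharMl ?groupV // mulrCA. Qed.

Lemma fourierMr b y z : b \in A -> y \in A -> z \in A ->
  E b (y * z) = beta b z^-1%g * E b y.
Proof. by move=> *; rewrite /E invMg bicharMr ?groupV // mulrCA. Qed.

Lemma fourierV b y : b \in A -> y \in A -> E b^-1%g y^-1%g = E b y.
Proof. by move=> Ab Ay; rewrite /E invgK -bicharVr. Qed.

Lemma fourier_invl y c : y \in A -> c \in A ->
  \sum_(b in A) beta b c * E b y = (y == c)%:R.
Proof.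
move=> Ay Ac; rewrite -[y == c](inj_eq (mulIg c^-1%g)) mulgV.
rewrite -fourier_sum_l ?groupM ?groupV //; apply: eq_bigr => d Ad.
by rewrite fourierMr ?groupV // invgK.
Qed.

Lemma fourier_invr b c : b \in A -> c \in A ->
  \sum_(y in A) beta b y * E c y = (b == c)%:R.
Proof.
move=> Ab Ac; rewrite eq_sym -[c == b](inj_eq (mulgI b^-1%g)) mulVg.
rewrite -fourier_sum_r ?groupM ?groupV //; apply: eq_bigr => d Ad.
by rewrite fourierMl ?groupV // -bicharVr ?groupV // invgK.
Qed.

Lemma fourier_convl r y z : r \in A -> y \in A -> z \in A ->
  \sum_(b in A) E b y * E (b^-1 * r) z = (y == z)%:R * E r y.
Proof.
move=> Ar Ay Az.
transitivity ((\sum_(b in A) beta b z * E b y) * E r z).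
  rewrite big_distrl /=; apply: eq_bigr => b Ab.
  by rewrite fourierMl ?groupV // -bicharVr ?groupV // invgK [E b y * _]mulrCA mulrA.
by rewrite fourier_invl //; case: eqP => [->|]; rewrite ?mul0r.
Qed.

Lemma fourier_convr b c g : b \in A -> c \in A -> g \in A ->
  \sum_(y in A) E b y * E c (g * y^-1) = (b == c)%:R * E b g.
Proof.
move=> Ab Ac Ag.
transitivity ((\sum_(y in A) beta c y * E b y) * E c g).
  rewrite big_distrl /=; apply: eq_bigr => y Ay.
  by rewrite fourierMr ?groupV // invgK [LHS]mulrCA mulrA.
by rewrite fourier_invr // eq_sym; case: eqP => [->|]; rewrite ?mul0r.
Qed.

(** The isotypic component of phi on which translation by c in A acts as the scalar beta b c. *)
Definition fourier (b : gT) (phi : gT -> k) (x : gT) : k :=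
  \sum_(y in A) E b y * phi (y * x)%g.

(** Isotypic components multiply like a grading by A. The two points x and y differ because the
    product of D(G) evaluates its second factor at a conjugate. *)
Lemma fourier_conv r phi psi x y : r \in A ->
  \sum_(b in A) fourier b phi x * fourier (b^-1 * r) psi y =
  fourier r (fun g => phi (g * x)%g * psi (g * y)%g) 1.
Proof.
move=> Ar; under eq_bigr do rewrite big_distrlr /=.
rewrite exchange_big; apply: eq_bigr => u Au; rewrite mulg1.
rewrite exchange_big (bigD1 u) //= [X in _ + X]big1 => [|v /andP[Av nvu]]; last first.
  under eq_bigr do rewrite mulrACA.
  by rewrite -big_distrl fourier_convl //= eq_sym (negPf nvu) !mul0r.
under eq_bigr do rewrite mulrACA.
by rewrite -big_distrl fourier_convl //= eqxx mul1r addr0.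
Qed.

Hypothesis centA : A \subset 'Z([set: gT])%g.

Lemma centralA x y : x \in A -> (x * y = y * x)%g.
Proof. by move=> Ax; have /centerP[_ ->] := subsetP centA _ Ax; rewrite ?inE. Qed.

(** The dual of [fourier_conv]: on the coalgebra side the isotypic projections are orthogonal
    idempotents. Centrality of A lets its elements move past y. *)
Lemma fourier_basis b c g x y : b \in A -> c \in A ->
  \sum_z fourier b (fun u => (u == (z^-1 * g)%g)%:R) x *
         fourier c (fun u => (u == z)%:R) y =
  (b == c)%:R * fourier b (fun u => (u == g)%:R) (y * x).
Proof.
move=> Ab Ac; under eq_bigr do rewrite big_distrr /=.
rewrite exchange_big /=.
transitivity (\sum_(v in A) E c v *
    \sum_(u in A) E b u * ((u * x)%g == ((v * y)^-1 * g)%g)%:R).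
  apply: eq_bigr => v Av; rewrite (bigD1 (v * y)%g) //= big1 => [|z nz].
    by rewrite eqxx mulr1 addr0 mulrC.
  by rewrite eq_sym (negPf nz) !mulr0.
transitivity (\sum_(v in A) E c v *
    \sum_(u in A) E b (u * v^-1) * ((u * (y * x))%g == g)%:R).
  apply: eq_bigr => v Av; congr (_ * _).
  rewrite (reindex_inj (mulIg v^-1%g)) /=.
  apply: eq_big => [u|u Au]; first by rewrite groupMr ?groupV.
  congr (_ * (_ : bool)%:R); rewrite -[LHS](inj_eq (mulgI (v * y)%g)) mulKVg.
  suff -> : (v * y * (u * v^-1 * x) = u * (y * x))%g by [].
  rewrite groupMr ?groupV // in Au.
  rewrite -(mulgA u) [LHS]mulgA -(centralA (v * y)%g Au) -mulgA.
  by congr (u * _)%g; rewrite (centralA y Av) -mulgA mulKVg.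
under eq_bigr do rewrite big_distrr /=.
rewrite exchange_big big_distrr /=; apply: eq_bigr => u Au.
under eq_bigr do rewrite mulrA.
rewrite -big_distrl fourier_convr //= eq_sym mulrA.
by case: eqP => [->|]; rewrite ?mul0r.
Qed.

(* The map a # h |-> a_(1) # p(a_(2)) h, where p sends e_y to the sum over b of *)
(* E b y F(b) if y is in A, and to 0 otherwise.                                *)
Definition hom_map (F : gT -> gT) (a : drinfeld k gT) : drinfeld k gT :=
  [ffun p => \sum_(b in A) fourier b (fun y => a (y, ((F b)^-1 * p.2)%g)) p.1].

Lemma hom_mapE F a x t : hom_map F a (x, t) =
  \sum_(b in A) fourier b (fun y => a (y, ((F b)^-1 * t)%g)) x.
Proof. by rewrite ffunE. Qed.

Lemma hom_map_linear F : linear (hom_map F).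
Proof.
move=> s a a'; apply/ffunP=> p; rewrite !ffunE scaler_sumr -big_split /=.
apply: eq_bigr => b _; rewrite scaler_sumr -big_split; apply: eq_bigr => y _ /=.
by rewrite !ffunE /GRing.scale /= mulrDr mulrCA.
Qed.

HB.instance Definition _ F :=
  GRing.isLinear.Build _ _ _ _ (hom_map F) (hom_map_linear F).

Section HomMap.

Variable F : gT -> gT.
Hypothesis FM : {in A &, {morph F : x y / (x * y)%g}}.
Hypothesis FZ : {in A, forall x, F x \in 'Z([set: gT])%g}.

Lemma centralF x y : x \in A -> (F x * y = y * F x)%g.
Proof. by move=> Ax; have /centerP[_ ->] := FZ Ax; rewrite ?inE. Qed.

Lemma conjg_centralF x y : x \in A -> (y ^ F x = y)%g.
Proof. by move=> Ax; rewrite conjgE -(centralF y Ax) mulKg. Qed.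

Lemma centralAJ x y : x \in A -> (x ^ y = x)%g.
Proof. by move=> Ax; rewrite conjgE (centralA y Ax) mulKg. Qed.

Lemma centralFV x y : x \in A -> ((F x)^-1 * y = y * (F x)^-1)%g.
Proof. by move=> Ax; rewrite -{1}(mulgK (F x) y) -centralF // !mulgA mulVg mul1g. Qed.

Lemma homF1 : F 1%g = 1%g.
Proof. by apply: (mulgI (F 1%g)); rewrite -FM ?group1 // !mulg1. Qed.

Lemma homFV x : x \in A -> F x^-1%g = (F x)^-1%g.
Proof.
by move=> Ax; apply: (mulgI (F x)); rewrite -FM ?groupV // !mulgV homF1.
Qed.

Lemma hom_map_dpure (chi : {ffun gT -> k}) h x t :
  (forall x y, chi (x * y)%g = chi x * chi y) ->
  hom_map F (dpure chi h) (x, t) =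
  chi x * \sum_(b in A) (\sum_(y in A) E b y * chi y) * (t == F b * h)%g%:R.
Proof.
move=> chiM; rewrite hom_mapE big_distrr /=; apply: eq_bigr => b Ab.
rewrite mulrA big_distrr big_distrl /=; apply: eq_bigr => y Ay.
rewrite dpureE chiM -(inj_eq (mulgI (F b))) mulKVg -[_ *+ _]mulr_natr [LHS]mulrA.
by congr (_ * _); rewrite [LHS]mulrA [LHS]mulrC.
Qed.

(** The Fourier transform of a character trivial on A is concentrated at 1, and F 1 = 1. *)
Lemma hom_map_dpure_id (chi : {ffun gT -> k}) h :
  (forall x y, chi (x * y)%g = chi x * chi y) -> {in A, forall x, chi x = 1} ->
  hom_map F (dpure chi h) = dpure chi h.
Proof.
move=> chiM chi1; apply/ffunP=> -[x t]; rewrite hom_map_dpure // dpureE -mulr_natr.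
congr (_ * _); rewrite (bigD1 1%g) //= [X in _ + X]big1 => [|b /andP[Ab nb]].
  under eq_bigr => y Ay do rewrite chi1 // mulr1.
  by rewrite fourier_sum_r // homF1 mul1g eqxx mul1r addr0.
under eq_bigr => y Ay do rewrite chi1 // mulr1.
by rewrite fourier_sum_r // (negPf nb) mul0r.
Qed.

(** The grading by A is multiplicative and so is F; A and the F b are central, so the conjugation in
    the product disturbs neither. *)
Lemma hom_map_mul : {morph hom_map F : a c / a * c}.
Proof.
move=> a c; apply/ffunP=> -[x t]; rewrite hom_mapE [RHS]ffunE /=.
(* Grouping this sum by r = b * b' gives the left side through [fourier_conv]; shifting z by the
   central F b gives the right side. *)
transitivity (\sum_(b in A) \sum_(b' in A) \sum_z
   fourier b (fun y => a (y, z)) x *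
   fourier b' (fun y => c (y, (z^-1 * ((F (b * b'))^-1 * t))%g)) (x ^ z)%g).
  under [RHS]eq_bigr => b Ab do rewrite (reindex_inj (mulgI b^-1%g)) /=.
  under [RHS]eq_bigr => b Ab do under eq_bigl do rewrite groupMl ?groupV //.
  rewrite [RHS]exchange_big; apply: eq_bigr => r Ar.
  rewrite exchange_big /=.
  under [RHS]eq_bigr => z _ do under eq_bigr do rewrite mulKVg.
  under [RHS]eq_bigr do rewrite fourier_conv // /fourier.
  rewrite [RHS]exchange_big; apply: eq_bigr => y Ay; rewrite ffunE mulg1 big_distrr.
  apply: eq_bigr => z _; do 2!congr (_ * _); congr (c (_, _)).
  by rewrite conjMg /= centralAJ.
under [RHS]eq_bigr do rewrite !hom_mapE big_distrlr /=.
rewrite [RHS]exchange_big; apply: eq_bigr => b Ab.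
rewrite [RHS]exchange_big; apply: eq_bigr => c' Ac.
rewrite [RHS](reindex_inj (mulgI (F b))) /=; apply: eq_bigr => z _.
rewrite mulKg; congr (_ * _); rewrite conjgM conjg_centralF //.
apply: eq_bigr => y Ay; congr (_ * c (_, _)).
rewrite FM // !invMg -!mulgA [RHS]mulgA (centralFV z^-1%g Ac).
by rewrite -mulgA.
Qed.

Lemma hom_map_counit a : counit (hom_map F a) = counit a.
Proof.
rewrite /counit; under eq_bigr do rewrite hom_mapE.
rewrite exchange_big /=; transitivity
    (\sum_(b in A) \sum_(y in A) E b y * \sum_t a (y, t)).
  apply: eq_bigr => b Ab; rewrite exchange_big; apply: eq_bigr => y Ay.
  rewrite big_distrr (reindex_inj (mulgI (F b))); apply: eq_bigr => t _ /=.
  by rewrite mulKg mulg1.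
rewrite exchange_big (bigD1 1%g) //= [X in _ + X]big1 => [|y /andP[Ay ny]].
  by rewrite -big_distrl /= fourier_sum_l // eqxx mul1r addr0.
by rewrite -big_distrl /= fourier_sum_l // (negPf ny) mul0r.
Qed.

Lemma hom_map_basisE g h x t : hom_map F (dbasis k g h) (x, t) =
  \sum_(b in A) fourier b (fun y => (y == g)%:R) x * (t == F b * h)%g%:R.
Proof.
rewrite hom_mapE; apply: eq_bigr => b Ab; rewrite big_distrl /=.
apply: eq_bigr => y Ay; rewrite dbasisE -mulrA -natrM mulnb.
by rewrite -[t == _](inj_eq (mulgI (F b)^-1%g)) mulKg.
Qed.

(** By [fourier_basis] the pairs b != c contribute 0, so the same group-like F b stands in both
    tensor factors. *)
Lemma hom_map_comul g h : comul (hom_map F (dbasis k g h)) =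
  \sum_x dtensor (hom_map F (dbasis k (x^-1 * g)%g h)) (hom_map F (dbasis k x h)).
Proof.
apply/ffunP=> -[[x1 t1] [x2 t2]]; rewrite comulE sum_ffunE /=.
under [RHS]eq_bigr do rewrite dtensorE /= !hom_map_basisE big_distrlr /=.
rewrite hom_map_basisE -mulr_natr big_distrl /=.
rewrite [RHS]exchange_big /=; apply: eq_bigr => b Ab.
rewrite [RHS]exchange_big /= (bigD1 b) //= [X in _ + X]big1 => [|c /andP[Ac nc]].
  under eq_bigr do rewrite mulrACA.
  rewrite -big_distrl /= fourier_basis // eqxx mul1r addr0 -mulrA -!natrM !mulnb.
  congr (_ * (_ : bool)%:R); case: eqP => //= ->.
  by rewrite eq_sym.
under eq_bigr do rewrite mulrACA.
by rewrite -big_distrl /= fourier_basis // eq_sym (negPf nc) !mul0r.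
Qed.

Lemma hom_map_antipode a : hom_map F (antipode a) = antipode (hom_map F a).
Proof.
apply/ffunP=> -[x t]; rewrite [RHS]ffunE !hom_mapE (reindex_inj invg_inj) /=.
apply: eq_big => [b|b]; rewrite groupV // => Ab.
rewrite /fourier (reindex_inj invg_inj) /=.
apply: eq_big => [y|y]; rewrite groupV // => Ay.
rewrite fourierV // ffunE /= homFV // !invgK; congr (_ * a (_, _)).
  rewrite conjgM conjg_centralF // invMg invgK.
  by rewrite -(centralA x^-1%g Ay) conjMg (centralAJ t Ay).
by rewrite invMg centralFV.
Qed.

End HomMap.

(** Orthogonality of the isotypic projections turns composition into the pointwise product. Hence
    the inverse of [hom_map F] comes from the pointwise inverse of F. *)
Lemma hom_map_comp (F F' : gT -> gT) a :
  hom_map F (hom_map F' a) = hom_map (fun x => F x * F' x)%g a.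
Proof.
apply/ffunP=> -[x t]; rewrite !hom_mapE.
apply: eq_bigr => b Ab.
transitivity (\sum_(y in A) \sum_(c in A) \sum_(v in A)
  E b y * E c v * a (v * (y * x), (F' c)^-1 * ((F b)^-1 * t))%g).
  apply: eq_bigr => y Ay; rewrite hom_mapE big_distrr; apply: eq_bigr => c Ac.
  by rewrite big_distrr; apply: eq_bigr => v Av /=; rewrite mulrA.
under eq_bigr => y Ay do under eq_bigr => c Ac do
  rewrite (reindex_inj (mulIg y^-1%g)) /=.
under eq_bigr => y Ay do under eq_bigr => c Ac do
  under eq_bigl do rewrite groupMr ?groupV //.
under eq_bigr do rewrite exchange_big /=.
rewrite exchange_big; apply: eq_bigr => u Au.
rewrite exchange_big (bigD1 b) //= [X in _ + X]big1 => [|c /andP[Ac nc]].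
  rewrite addr0; under eq_bigr do rewrite -mulgA mulKg.
  by rewrite -big_distrl fourier_convr //= eqxx !mul1r invMg mulgA.
under eq_bigr do rewrite -mulgA mulKg.
by rewrite -big_distrl fourier_convr //= eq_sym (negPf nc) !mul0r.
Qed.

Lemma hom_map1 a : hom_map (fun _ => 1%g) a = a.
Proof.
apply/ffunP=> -[x t]; rewrite hom_mapE exchange_big (bigD1 1%g) //=.
rewrite [X in _ + X]big1 => [|y /andP[Ay ny]].
  by rewrite -big_distrl /= fourier_sum_l // eqxx mul1r addr0 invg1 !mul1g.
by rewrite -big_distrl /= fourier_sum_l // (negPf ny) mul0r.
Qed.

Lemma eq_hom_map F F' : {in A, F =1 F'} -> hom_map F =1 hom_map F'.
Proof.
by move=> eF a; apply/ffunP=> p; rewrite !ffunE; apply: eq_bigr => b Ab; rewrite eF.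
Qed.

Lemma hom_map_hopf (F : gT -> gT) : {in A &, {morph F : x y / (x * y)%g}} ->
  {in A, forall x, F x \in 'Z([set: gT])%g} -> hopf_of (hom_map F) =1 hom_map F.
Proof.
move=> FM FZ; apply: hopf_ofE.
- exists (hom_map (fun x => (F x)^-1%g)) => a /=; rewrite hom_map_comp.
    by rewrite -[RHS]hom_map1; apply: eq_hom_map => b _; rewrite mulVg.
  by rewrite -[RHS]hom_map1; apply: eq_hom_map => b _; rewrite mulgV.
- by apply: hom_map_dpure_id => // [x y|x _]; rewrite !ffunE ?mulr1.
- exact: hom_map_mul.
- exact: hom_map_counit.
- exact: hom_map_comul.
exact: hom_map_antipode.
Qed.

End Fourier.

(** * Central automorphisms of G *)

Section CentralAutomorphisms.

Import GRing.Theory GroupScope.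
Local Open Scope ring_scope.
Local Open Scope group_scope.

Variable gT : finGroupType.
Local Notation G := [set: gT].

Lemma sub_der1 (K : {group gT}) :
  (forall x y, [~ x, y] \in K) -> G^`(1) \subset K.
Proof.
by move=> cK; rewrite gen_subG; apply/subsetP=> _ /imset2P[x y _ _ ->].
Qed.

Lemma in_center_conjg (x : gT) : (forall h, x ^ h = x)%g -> x \in 'Z([set: gT])%g.
Proof.
move=> xJ; apply/centerP; split=> [|h _]; first exact: in_setT.
by apply/commgP/conjg_fixP.
Qed.

(** Computing s (z ^ x) in two ways gives s z ^ s x = s z ^ x, and every element of G is some s
    z. *)
Lemma conjg_invariant_perm (s : {perm gT}) :
  {morph s : x y / (x * y)%g} -> (forall x h, s (x ^ h)%g = (s x ^ h)%g) ->
  forall x, (s x * x^-1)%g \in 'Z(G)%g.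
Proof.
move=> sM sJ x; apply: in_center_conjg => y; rewrite -[y](permKV s).
set z := (s^-1)%g y; have sV u : s u^-1%g = (s u)^-1%g.
  have s1 : s 1%g = 1%g by apply: (mulgI (s 1%g)); rewrite -sM !mulg1.
  by apply: (mulgI (s u)); rewrite mulgV -sM mulgV.
have : (s z ^ s x = s z ^ x)%g by rewrite -[RHS]sJ /conjg !sM sV.
move/(congr1 (conjg^~ x^-1)%g); rewrite conjgK -conjgM => zx.
by apply/conjg_fixP/commgP; apply: commute_sym; apply/commgP/conjg_fixP.
Qed.

Variable w : {perm gT}.
Hypothesis cw : w \in Aut_c' gT.

Lemma Aut_c'1 : w 1 = 1.
Proof. by apply: (mulgI (w 1)); rewrite -(Aut_c'_morph cw) !mulg1. Qed.

Lemma Aut_c'V x : w x^-1 = (w x)^-1.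
Proof.
by apply: (mulgI (w x)); rewrite mulgV -(Aut_c'_morph cw) mulgV Aut_c'1.
Qed.

Lemma Aut_c'_ZD x : w x * x^-1 \in ZD gT.
Proof.
by move: cw; rewrite Aut_c'E => /andP[_ /forallP/(_ x^-1)]; rewrite invgK.
Qed.

Lemma Aut_c'_conjg x y : w (x ^ y) = w x ^ y.
Proof.
have wM := Aut_c'_morph cw.
have /setIP[/centerP[_ c] _] := Aut_c'_ZD y.
have ->: w (x ^ y) = w x ^ w y by rewrite /conjg !wM Aut_c'V.
rewrite -[w y](mulgKV y) conjgM; congr (_ ^ y).
by rewrite conjgE -c ?mulKg ?inE.
Qed.

(** A commutator does not change when its entries are multiplied by central elements. *)
Lemma Aut_c'_fix_der x : x \in G^`(1) -> w x = x.
Proof.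
have wM := Aut_c'_morph cw.
have gK : group_set [set x | w x == x].
  apply/group_setP; rewrite inE Aut_c'1 eqxx; split=> // y z.
  by rewrite !inE wM => /eqP-> /eqP->.
suff /subsetP s : G^`(1) \subset Group gK by move/s; rewrite inE => /eqP.
apply: sub_der1 => y z; rewrite inE /= commgEl wM Aut_c'_conjg.
have /setIP[/centerP[_ c] _] := Aut_c'_ZD y.
have cz : (w y * y^-1) ^ z = w y * y^-1 by rewrite conjgE c ?inE // mulKg.
have <- : w y * y^-1 * y = w y by rewrite mulgKV.
by rewrite Aut_c'V conjMg cz -{1}[w y](mulgKV y) invMg -mulgA mulKg.
Qed.

End CentralAutomorphisms.

(** * Characters of G, and the automorphism of D(G) attached to w *)

Section Characters.

Import GRing.Theory.
Local Open Scope ring_scope.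

Variables (k : closedFieldType) (gT : finGroupType).
Local Notation G := [set: gT].
Implicit Type chi : {ffun gT -> k}.

Lemma is_char_der chi x : is_char chi -> x \in G^`(1)%g -> chi x = 1.
Proof.
move=> [c1 cM].
have gK : group_set [set x | chi x == 1].
  apply/group_setP; rewrite inE c1 eqxx; split=> // y z.
  by rewrite !inE cM => /eqP-> /eqP->; rewrite mulr1.
suff /subsetP s : G^`(1)%g \subset Group gK by move/s; rewrite inE => /eqP.
apply: sub_der1 => y z; rewrite inE /= commgEl conjgE !cM.
by rewrite [chi z^-1%g * _]mulrC -(mulrA (chi y)) -cM mulgV c1 mulr1 -cM mulVg c1.
Qed.

(** A nondegenerate bicharacter on G / G', with one argument frozen, pulls back to a character of G;
    these suffice to separate cosets. *)
Lemma is_char_separates x : [pchar k] =i pred0 ->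
  (forall chi, is_char chi -> chi x = 1) -> x \in G^`(1)%g.
Proof.
move=> chark x1; have nG y : y \in 'N(G^`(1))%g.
  by rewrite (subsetP (der_norm 1 _)) ?inE.
have [beta [_ b1 bM nd]] := nondeg_bichar_exists chark (der_abelian 0 G).
have inQ y : coset G^`(1) y \in (G^`(0) / G^`(1))%g.
  by rewrite derg0; apply: mem_quotient; apply: in_setT.
apply: coset_idr (nG x) _; apply: nd (inQ x) _ => z Qz.
have cc : is_char [ffun y => beta (coset G^`(1) y)%g z].
  split=> [|u v]; rewrite !ffunE; first by rewrite morph1 b1.
  by rewrite morphM ?nG // bM //; apply: inQ.
by have := x1 _ cc; rewrite ffunE.
Qed.

Definition aut_map (w : {perm gT}) (a : drinfeld k gT) : drinfeld k gT :=
  [ffun p => a ((w^-1)%g p.1, p.2)].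

Lemma aut_map_linear w : linear (aut_map w).
Proof. by move=> s a c; apply/ffunP=> p; rewrite !ffunE. Qed.

HB.instance Definition _ w :=
  GRing.isLinear.Build _ _ _ _ (aut_map w) (aut_map_linear w).

Lemma aut_mapE w a x t : aut_map w a (x, t) = a ((w^-1)%g x, t).
Proof. by rewrite ffunE. Qed.

Lemma aut_map_basis w g h : aut_map w (dbasis k g h) = dbasis k (w g) h.
Proof.
by apply/ffunP=> -[x t]; rewrite aut_mapE !dbasisE -(inj_eq (@perm_inj _ w)) permKV.
Qed.

Lemma aut_map_comp w w' a : aut_map w' (aut_map w a) = aut_map (w * w')%g a.
Proof. by apply/ffunP=> -[x t]; rewrite !aut_mapE invMg permM. Qed.

Lemma aut_map1 a : aut_map 1%g a = a.
Proof. by apply/ffunP=> -[x t]; rewrite aut_mapE invg1 perm1. Qed.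

Section PermHopf.

Variable w : {perm gT}.
Hypothesis cw : w \in Aut_c' gT.

(** w moves each element by a factor in G', where characters are 1. *)
Lemma aut_map_dpure chi h : is_char chi -> aut_map w (dpure chi h) = dpure chi h.
Proof.
move=> cc; apply/ffunP=> -[x t]; rewrite aut_mapE !dpureE; congr (_ *+ _).
have cV : (w^-1)%g \in Aut_c' gT by rewrite groupV.
rewrite -[X in chi X](mulgKV x); have [_ ->] := cc.
by have /setIP[_ /(is_char_der cc)->] := Aut_c'_ZD cV x; rewrite mul1r.
Qed.

Lemma aut_map_hopf : hopf_of (aut_map w) =1 aut_map w.
Proof.
have cV : (w^-1)%g \in Aut_c' gT by rewrite groupV.
apply: hopf_ofE => [||a c|a|g h|a] /=.
- exists (aut_map w^-1%g) => a /=; rewrite aut_map_comp ?mulgV ?mulVg aut_map1 //.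
- by apply: aut_map_dpure; split=> [|x y]; rewrite !ffunE ?mulr1.
- apply/ffunP=> -[x t]; rewrite !ffunE; apply: eq_bigr => z _.
  by rewrite !aut_mapE /= (Aut_c'_conjg cV).
- by apply: eq_bigr => t _; rewrite aut_mapE (Aut_c'1 cV).
- rewrite aut_map_basis comul_basis (reindex_inj (@perm_inj _ w)).
  apply: eq_bigr => x _; rewrite !aut_map_basis.
  by rewrite (Aut_c'_morph cw) (Aut_c'V cw).
apply/ffunP=> -[x t]; rewrite !ffunE /=.
by rewrite (Aut_c'_conjg cV) (Aut_c'V cV).
Qed.

End PermHopf.

(** As w fixes A pointwise, it commutes with the translations by A from which the isotypic
    components are built. *)
Lemma aut_map_hom_map (A : {group gT}) beta F w a :
  A \subset (G^`(1))%g -> w \in Aut_c' gT ->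
  hom_map A beta F (aut_map w a) = aut_map w (hom_map A beta F a).
Proof.
move=> sAG cw; apply/ffunP=> -[x t]; rewrite aut_mapE !hom_mapE.
apply: eq_bigr => b Ab; apply: eq_bigr => y Ay; rewrite aut_mapE.
have cV : (w^-1)%g \in Aut_c' gT by rewrite groupV.
by rewrite (Aut_c'_morph cV) (Aut_c'_fix_der cV) ?(subsetP sAG).
Qed.

End Characters.

(** * The components u and p of an automorphism that fixes every 1 # g *)

Section Components.

Import GRing.Theory.
Local Open Scope ring_scope.

Variables (k : fieldType) (gT : finGroupType).
Local Notation D := (drinfeld k gT).

Lemma mul_dpure_grp (a : D) h x t :
  (a * dpure (feps k gT) h) (x, t) = a (x, (t * h^-1)%g).
Proof.
rewrite ffunE (bigD1 (t * h^-1)%g) //= big1 => [|z nz]; rewrite dpureE ffunE.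
  by rewrite invMg invgK mulgKV eqxx mulr1 addr0.
rewrite -(inj_eq (mulgI z)) mulKVg -(inj_eq (mulIg h^-1%g)) mulgK eq_sym.
by rewrite (negPf nz) mulr0.
Qed.

Lemma mul_grp_dpure (a : D) h x t :
  (dpure (feps k gT) h * a) (x, t) = a ((x ^ h)%g, (h^-1 * t)%g).
Proof.
rewrite ffunE (bigD1 h) //= big1 => [|z nz]; rewrite dpureE ffunE.
  by rewrite eqxx mul1r addr0.
by rewrite (negPf nz) mul0r.
Qed.

Lemma dbasis_split g h : dbasis k g h = dbasis k g 1%g * dpure (feps k gT) h.
Proof.
apply/ffunP=> -[x t]; rewrite mul_dpure_grp !dbasisE; congr ((_ && _)%:R).
by rewrite -[RHS](inj_eq (mulIg h)) mulgKV mul1g.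
Qed.

Lemma dpure_sum (f : {ffun gT -> k}) h : dpure f h = \sum_g f g *: dbasis k g h.
Proof.
apply/ffunP=> -[x t]; rewrite dpureE sum_ffunE (bigD1 x) //= big1 => [|g ng].
  by rewrite addr0 ffunE dbasisE eqxx /GRing.scale /= mulr_natr.
by rewrite ffunE dbasisE eq_sym (negPf ng) /GRing.scale /= mulr0.
Qed.

Definition fixes_grp (psi : hopfAut k gT) : Prop :=
  forall h, psi (dpure (feps k gT) h) = dpure (feps k gT) h.

Lemma fixes_grp_V psi : fixes_grp psi -> fixes_grp psi^-1%g.
Proof.
move=> fg h; rewrite -{1}[dpure _ h]fg -hopfAutM mulgV; exact: hopfAut1.
Qed.

Definition coefM (psi : hopfAut k gT) g x t : k := psi (dbasis k g 1%g) (x, t).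
Definition coefU (psi : hopfAut k gT) g x : k := \sum_t coefM psi g x t.
Definition coefP (psi : hopfAut k gT) g t : k := coefM psi g 1%g t.

Section Coefficients.

Variable psi : hopfAut k gT.
Hypothesis fg : fixes_grp psi.
Local Notation M := (coefM psi).
Local Notation U := (coefU psi).
Local Notation P := (coefP psi).

Lemma hopfaut_mul a b : psi (a * b) = psi a * psi b.
Proof. by have [_ [_ m] _ _ _] := hopfAutP psi. Qed.

Lemma hopfaut_basis g h x t : psi (dbasis k g h) (x, t) = M g x (t * h^-1)%g.
Proof. by rewrite dbasis_split hopfaut_mul fg mul_dpure_grp. Qed.

Lemma hopfaut_dpure (f : {ffun gT -> k}) h x t :
  psi (dpure f h) (x, t) = \sum_g f g * M g x (t * h^-1)%g.
Proof.
rewrite dpure_sum linear_sum sum_ffunE; apply: eq_bigr => g _.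
by rewrite linearZ ffunE hopfaut_basis.
Qed.

(** Conjugation of e_g by h is multiplication by 1 # h on both sides, and psi fixes 1 # h. *)
Lemma M_conjg g h x t : M (g ^ h) (x ^ h)%g (t ^ h)%g = M g x t.
Proof.
have /(congr1 (fun a => psi a (x, (t * h)%g))) :
    dpure (feps k gT) h * dbasis k (g ^ h) 1%g =
    dbasis k g 1%g * dpure (feps k gT) h.
  apply/ffunP=> -[y z]; rewrite mul_dpure_grp mul_grp_dpure !dbasisE.
  congr ((_ && _)%:R); first by rewrite (inj_eq (conjg_inj h)).
  by rewrite -(inj_eq (mulgI h)) -[RHS](inj_eq (mulIg h)) mulKVg mulgKV mulg1 mul1g.
by rewrite !hopfaut_mul fg mul_dpure_grp mul_grp_dpure mulgK /coefM.
Qed.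

Lemma M_comul g x1 t1 x2 t2 : M g (x2 * x1)%g t1 *+ (t1 == t2) =
  \sum_y M (y^-1 * g)%g x1 t1 * M y x2 t2.
Proof.
have [_ _ _ dpsi _] := hopfAutP psi.
have := dpsi (dbasis k g 1%g); rewrite comul_basis dtensor_map_sum => /ffunP.
move/(_ ((x1, t1), (x2, t2))); rewrite comulE sum_ffunE /= => ->.
by apply: eq_bigr => y _; rewrite dtensor_mapE dtensorE.
Qed.

Lemma M_mul g g' x t :
  \sum_y M g x y * M g' (x ^ y)%g (y^-1 * t)%g = M g x t *+ (g == g').
Proof.
have := hopfaut_mul (dbasis k g 1%g) (dbasis k g' 1%g).
rewrite dbasisM mul1g invg1 !mulg1 => /ffunP/(_ (x, t)); rewrite [in RHS]ffunE => <-.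
by case: eqP => // _; rewrite linear0 ffunE.
Qed.

Lemma M_unit x t : \sum_g M g x t = (t == 1%g)%:R.
Proof.
have := congr1 (fun a : D => a (x, t)) (fg 1%g); rewrite hopfaut_dpure dpureE ffunE.
by move<-; apply: eq_bigr => g _; rewrite ffunE mul1r invg1 mulg1.
Qed.

(** Apply id (x) counit to the first leg of the coproduct and ev_1 (x) id to the second; [M_PU]
    exchanges the two legs. *)
Lemma M_UP g x t : M g x t = \sum_y U (y^-1 * g)%g x * P y t.
Proof.
transitivity (\sum_s M g x s *+ (s == t)).
  rewrite (bigD1 t) //= big1 => [|s ns]; first by rewrite eqxx addr0.
  by rewrite (negPf ns).
rewrite -{1}[x]mul1g; under eq_bigr do rewrite M_comul.
by rewrite exchange_big; apply: eq_bigr => y _; rewrite -big_distrl.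
Qed.

Lemma M_PU g x t : M g x t = \sum_y P (y^-1 * g)%g t * U y x.
Proof.
transitivity (\sum_s M g x t *+ (t == s)).
  rewrite (bigD1 t) //= big1 => [|s ns]; first by rewrite eqxx addr0.
  by rewrite eq_sym (negPf ns).
rewrite -{1}[x]mulg1; under eq_bigr do rewrite M_comul.
by rewrite exchange_big; apply: eq_bigr => y _; rewrite -big_distrr.
Qed.

Lemma P_comul g t1 t2 : P g t1 *+ (t1 == t2) = \sum_y P (y^-1 * g)%g t1 * P y t2.
Proof. by rewrite -M_comul mulg1. Qed.

Lemma P_mul g g' t : \sum_y P g y * P g' (y^-1 * t)%g = P g t *+ (g == g').
Proof. by rewrite -M_mul; apply: eq_bigr => y _; rewrite conj1g. Qed.

End Coefficients.

(** The group coordinate of psi (e_g # 1) is summed out because phi fixes it, so u is functorial;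
    applied to psi and its inverse, this makes U invertible. *)
Lemma U_mul psi phi g x : fixes_grp psi -> fixes_grp phi ->
  coefU (psi * phi)%g g x = \sum_y coefU psi g y * coefU phi y x.
Proof.
move=> fpsi fphi; rewrite /coefU.
transitivity (\sum_t \sum_y \sum_s coefM psi g y s * coefM phi y x (t * s^-1)%g).
  apply: eq_bigr => t _; rewrite {1}/coefM hopfAutM [psi _ in LHS]dsumE linear_sum.
  rewrite sum_ffunE pair_big; apply: eq_bigr => -[y s] _ /=.
  by rewrite linearZ [LHS]ffunE (hopfaut_basis fphi).
rewrite exchange_big; apply: eq_bigr => y _.
rewrite exchange_big big_distrl; apply: eq_bigr => s _ /=.
by rewrite (reindex_inj (mulIg s)) big_distrr; apply: eq_bigr => t _; rewrite /= mulgK.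
Qed.

Lemma U_one g x : coefU (1%g : hopfAut k gT) g x = (x == g)%:R.
Proof.
rewrite /coefU (bigD1 1%g) //= big1 => [|t nt]; rewrite /coefM hopfAut1 dbasisE.
  by rewrite eqxx andbT addr0.
by rewrite (negPf nt) andbF.
Qed.

Section CentralImage.

Variable psi : hopfAut k gT.
Hypothesis fg : fixes_grp psi.
Local Notation M := (coefM psi).
Local Notation U := (coefU psi).
Local Notation P := (coefP psi).

(* M_UP and M_PU compute M from the two orders of the coproduct; cancel the *)
(* invertible matrix U.                                                     *)
Lemma P_comm g z t : P (z^-1 * g)%g t = P (g * z^-1)%g t.
Proof.
pose V := coefU psi^-1%g; have fV := fixes_grp_V fg.
have UV y u : \sum_x U y x * V x u = (u == y)%:R by rewrite -U_mul // mulgV U_one.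
have e x : \sum_y P (y^-1 * g)%g t * U y x = \sum_y P (g * y^-1)%g t * U y x.
  rewrite -M_PU M_UP (reindex_inj (mulgI g)) (reindex_inj invg_inj) /=.
  by apply: eq_bigr => y _; rewrite invMg invgK mulgKV mulrC.
have S (Q : gT -> k) : \sum_x (\sum_y Q y * U y x) * V x z = Q z.
  under eq_bigr do rewrite big_distrl /=; rewrite exchange_big /=.
  under eq_bigr do (under eq_bigr do rewrite -mulrA; rewrite -big_distrr UV /=).
  rewrite (bigD1 z) //= big1 => [|y ny]; first by rewrite eqxx mulr1 addr0.
  by rewrite eq_sym (negPf ny) mulr0.
rewrite -[LHS](S (fun y => P (y^-1 * g)%g t)) -[RHS](S (fun y => P (g * y^-1)%g t)).
by apply: eq_bigr => x _; rewrite e.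
Qed.

Lemma P_conjgl g h t : P (g ^ h)%g t = P g t.
Proof. by rewrite conjgE P_comm mulgK. Qed.

Lemma P_conjgr g h t : P g (t ^ h)%g = P g t.
Proof. by rewrite -(P_conjgl g h) -[RHS](M_conjg fg g h) conj1g. Qed.

(** For a conjugate t' != t the sum in [P_comul] vanishes; but P does not distinguish t' from t, so
    that sum is also P g t. *)
Lemma P_centerr g t : P g t != 0 -> t \in 'Z([set: gT])%g.
Proof.
move=> nP; apply: in_center_conjg => h; apply/esym/eqP; apply: contraR nP => nt.
have := P_comul psi g t (t ^ h)%g; rewrite (negPf nt) mulr0n => ->.
by under eq_bigr do rewrite P_conjgr; rewrite -P_comul // eqxx.
Qed.

(** The same argument with [P_mul]: distinct conjugates of g would have equal and orthogonal
    idempotents as images under p. *)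
Lemma P_centerl g t : P g t != 0 -> g \in 'Z([set: gT])%g.
Proof.
move=> nP; apply: in_center_conjg => h; apply/esym/eqP; apply: contraR nP => ng.
have := P_mul psi g (g ^ h)%g t; rewrite (negPf ng) mulr0n => <-.
by under eq_bigr do rewrite P_conjgl; rewrite P_mul // eqxx.
Qed.

Lemma M_centerr g x t : M g x t != 0 -> t \in 'Z([set: gT])%g.
Proof.
apply: contraR => nt; rewrite M_UP // big1 // => y _.
by rewrite (contraNeq (@P_centerr y t)) ?mulr0.
Qed.

(** The group coordinates that occur are central, so the conjugation in [M_mul] disappears and
    summing them out makes u multiplicative. *)
Lemma U_mul_orth g g' x : U g x * U g' x = U g x *+ (g == g').
Proof.
rewrite -sumrMnl; under [RHS]eq_bigr do rewrite -M_mul //.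
rewrite exchange_big big_distrl; apply: eq_bigr => y _ /=; rewrite -big_distrr /=.
have [->|/M_centerr /centerP[_ cy]] := eqVneq (M g x y) 0; first by rewrite !mul0r.
rewrite conjgE -cy ?inE // mulKg; congr (_ * _).
by rewrite [RHS](reindex_inj (mulgI y)); apply: eq_bigr => t _; rewrite mulKg.
Qed.

Lemma U_sum x : \sum_g U g x = 1.
Proof.
rewrite exchange_big; under eq_bigr do rewrite M_unit //=.
by rewrite (bigD1 1%g) //= big1 ?addr0 ?eqxx // => t /negPf->.
Qed.

Lemma U_comul g x y : U g (y * x)%g = \sum_z U (z^-1 * g)%g x * U z y.
Proof.
under [RHS]eq_bigr do rewrite big_distrlr /=.
rewrite exchange_big; apply: eq_bigr => t _; rewrite exchange_big /=.
under eq_bigr do rewrite -M_comul //.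
rewrite (bigD1 t) //= big1 => [|u nu]; first by rewrite eqxx addr0.
by rewrite eq_sym (negPf nu).
Qed.

Lemma U_conjg g h x : U (g ^ h) (x ^ h)%g = U g x.
Proof.
by rewrite /U (reindex_inj (conjg_inj h)); apply: eq_bigr => t _; rewrite M_conjg.
Qed.

(** For each x the scalars U g x are orthogonal idempotents with sum 1, which defines s x.
    Invertibility of U makes s injective, [U_comul] makes it multiplicative and [U_conjg]
    equivariant. *)
Lemma U_perm : exists s : {perm gT}, [/\ forall g x, U g x = (g == s x)%:R,
  {morph s : x y / (x * y)%g} & forall x h, s (x ^ h)%g = (s x ^ h)%g].
Proof.
have /fin_all_exists[s sP] x : exists y, forall g, U g x = (g == y)%:R.
  by apply: orth_idem_delta (U_sum x) => g g'; apply: U_mul_orth.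
have s_inj : injective s.
  move=> x y exy; have VU z u : \sum_g coefU psi^-1%g z g * U g u = (u == z)%:R.
    by rewrite -U_mul ?mulVg ?U_one //; apply: fixes_grp_V.
  apply/eqP/(@natr_bool_inj k); rewrite -VU; under eq_bigr do rewrite sP exy -sP.
  by rewrite VU eqxx.
exists (perm s_inj); split=> [g x|x y|x h]; rewrite !permE ?sP //.
  apply/esym/eqP/(@natr_bool_inj k); rewrite -sP U_comul.
  rewrite (bigD1 (s x)) //= big1 => [|z nz].
    by rewrite !sP mulKg !eqxx mulr1 addr0.
  by rewrite (sP x z) (negPf nz) mulr0.
by apply/esym/eqP/(@natr_bool_inj k); rewrite -sP U_conjg sP eqxx.
Qed.

Lemma M_perm (s : {perm gT}) g x t : (forall g x, U g x = (g == s x)%:R) ->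
  M g x t = P (g * (s x)^-1)%g t.
Proof.
move=> sP; rewrite M_UP // (bigD1 (g * (s x)^-1)%g) //= big1 => [|z nz].
  by rewrite sP invMg invgK mulgKV eqxx mul1r addr0.
rewrite sP; case: (_^-1 * _ =P _)%g nz => [<-|]; last by rewrite mul0r.
by rewrite invMg invgK mulKVg eqxx.
Qed.

End CentralImage.
End Components.

(** * Automorphisms in the kernel: extracting w and F *)

Section Kernel.

Import GRing.Theory.
Local Open Scope ring_scope.

Variables (k : closedFieldType) (gT : finGroupType).
Hypothesis chark : [pchar k] =i pred0.
Local Notation G := [set: gT].
Local Notation A := (ZD gT).
Implicit Types (psi : hopfAut k gT) (chi : {ffun gT -> k}).

Lemma proj_fun_dpure (f : {ffun gT -> k}) h : proj_fun (dpure f h) = f.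
Proof.
apply/ffunP=> x; rewrite ffunE (bigD1 h) //= big1 => [|y ny]; rewrite dpureE.
  by rewrite eqxx addr0.
by rewrite (negPf ny).
Qed.

Lemma proj_grp_dpure chi h : is_char chi -> proj_grp (dpure chi h) = fbasis k h.
Proof. by move=> [c1 _]; apply/ffunP=> x; rewrite !ffunE c1. Qed.

Lemma fbasis_inj : injective (@fbasis k gT).
Proof.
move=> g h /ffunP/(_ g); rewrite !ffunE eqxx.
by case: eqP => // _ /eqP; rewrite oner_eq0.
Qed.

Lemma is_char_feps : is_char (feps k gT).
Proof. by split=> [|x y]; rewrite !ffunE ?mulr1. Qed.

Lemma hopfaut_char psi chi h : is_char chi ->
  exists chi' h', is_char chi' /\ psi (dpure chi h) = dpure chi' h'.
Proof.
move=> cc; apply/grouplikeP; have gl : `[< grouplike (dpure chi h) >].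
  by apply/asboolP/grouplikeP; exists chi, h.
exact: gammaP (res psi (Gamma gl)).
Qed.

Lemma res_kerP psi : res_ker psi <->
  forall chi h, is_char chi -> psi (dpure chi h) = dpure chi h.
Proof.
split=> [rk chi h cc|fx x].
  have gl : `[< grouplike (dpure chi h) >].
    by apply/asboolP/grouplikeP; exists chi, h.
  by have /(congr1 val) := rk (Gamma gl).
apply: val_inj => /=; have /grouplikeP[chi [h [cc ->]]] := gammaP x.
exact: fx.
Qed.

Lemma res_ker_fixes_grp psi : res_ker psi -> fixes_grp psi.
Proof. by move/res_kerP => fx h; apply: fx is_char_feps. Qed.

(** psi (1 # h) is group-like, hence of the form chi # z; r reads off chi and v reads off z. *)
Lemma Lambda_cP psi : Lambda_c psi <-> fixes_grp psi.
Proof.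
split=> [[vid rtriv] h|fg].
  have [chi [z [cc e]]] := hopfaut_char psi h is_char_feps.
  have := rtriv h; rewrite /comp_r e proj_fun_dpure => <-.
  have := vid h; rewrite /comp_v e proj_grp_dpure // => /fbasis_inj->.
  by [].
split=> h; rewrite /comp_v /comp_r fg ?proj_fun_dpure //.
exact: proj_grp_dpure is_char_feps.
Qed.

Section FixesGrp.

Variable psi : hopfAut k gT.
Hypothesis fg : fixes_grp psi.
Local Notation P := (coefP psi).

(** Both the support of P in g and the displacement of s are central, so under this inclusion every
    character takes the value 1 on them. *)
Lemma fixes_grp_res_ker : 'Z(G)%g \subset (G^`(1))%g -> res_ker psi.
Proof.
move=> sZ; have [s [sP sM sJ]] := U_perm fg; apply/res_kerP => chi h cc.
have [c1 cM] := cc; have cZ g : g \in 'Z(G)%g -> chi g = 1.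
  by move=> Zg; rewrite (is_char_der cc) ?(subsetP sZ).
apply/ffunP=> -[x t]; rewrite hopfaut_dpure // dpureE.
under eq_bigr do rewrite (M_perm _ _ _ sP).
rewrite (reindex_inj (mulIg (s x))) /=; under eq_bigr do rewrite mulgK cM.
transitivity (chi (s x) * \sum_g P g (t * h^-1)%g).
  rewrite big_distrr; apply: eq_bigr => g _ /=.
  have [->|/(P_centerl fg)/cZ->] := eqVneq (P g (t * h^-1)%g) 0.
    by rewrite !mulr0.
  by rewrite mul1r.
rewrite (M_unit fg) -(inj_eq (mulIg h)) mulgKV mul1g mulr_natr.
rewrite -[s x](mulgKV x) cM (cZ (_ * _)%g) ?mul1r //; exact: conjg_invariant_perm.
Qed.

End FixesGrp.

Section ResKer.

Variable psi : hopfAut k gT.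
Hypothesis rk : res_ker psi.
Let fg := res_ker_fixes_grp rk.
Local Notation U := (coefU psi).
Local Notation P := (coefP psi).
Local Notation M := (coefM psi).

Lemma char_M chi x t : is_char chi -> \sum_g chi g * M g x t = chi x *+ (t == 1%g).
Proof.
move=> cc; have /res_kerP/(_ chi 1%g cc)/ffunP/(_ (x, t)) := rk.
by rewrite hopfaut_dpure // dpureE => <-; apply: eq_bigr => g _; rewrite invg1 mulg1.
Qed.

(** As p (chi) = 1, one has chi (g) p (e_g) = p (chi) p (e_g) = p (e_g), so chi g = 1 for all
    chi. *)
Lemma P_ZD g t : P g t != 0 -> g \in A.
Proof.
move=> nP; rewrite inE (P_centerl fg nP); apply: (is_char_separates chark) => chi cc.
apply: (mulIf nP); rewrite mul1r.
transitivity (\sum_g' chi g' * (P g' t *+ (g' == g))).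
  rewrite (bigD1 g) //= big1 => [|g' /negPf->]; last by rewrite mulr0.
  by rewrite eqxx addr0.
under eq_bigr do rewrite -P_mul big_distrr /=.
rewrite exchange_big (bigD1 1%g) //= [X in _ + X]big1 => [|y /negPf ny].
  under eq_bigr do rewrite mulrA.
  rewrite -big_distrl /= char_M // eqxx invg1 mul1g addr0.
  by have [-> _] := cc; rewrite mul1r.
by under eq_bigr do rewrite mulrA; rewrite -big_distrl /= char_M // ny mul0r.
Qed.

Lemma res_ker_perm : exists2 w : {perm gT}, w \in Aut_c' gT &
  forall g x t, M g x t = P (g * (w^-1)%g x^-1)%g t.
Proof.
have [s [sP sM sJ]] := U_perm fg.
have cs : s \in Aut_c' gT.
  rewrite Aut_c'E; apply/andP; split.
    rewrite inE; apply/andP; split; last by apply/morphicP=> x y _ _; apply: sM.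
    by apply/subsetP=> x; rewrite !inE.
  apply/forallP=> x; rewrite -{2}[x]invgK inE conjg_invariant_perm //.
  apply: (is_char_separates chark) => chi cc; have [c1 cM] := cc.
  have cU y : chi (s y) = chi y.
    transitivity (\sum_g chi g * U g y).
      rewrite (bigD1 (s y)) //= big1 => [|g ng]; rewrite sP.
        by rewrite eqxx mulr1 addr0.
      by rewrite (negPf ng) mulr0.
    under eq_bigr do rewrite big_distrr /=.
    rewrite exchange_big (bigD1 1%g) //= [X in _ + X]big1 => [|t /negPf nt].
      by rewrite char_M // eqxx addr0.
    by rewrite char_M // nt.
  by rewrite cM cU -cM mulgV.
(* U g x = 1 exactly when g = s x, so u sends e_g to e_(s^-1 g). *)
exists s^-1%g; first by rewrite groupV.
by move=> g x t; rewrite invgK (Aut_c'V cs); apply: M_perm.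
Qed.

Variable beta : gT -> gT -> k.
Hypothesis betaP : nondeg_bichar A beta.

(** Q a below holds the coordinates of p (beta a), where beta a is extended by 0 off A. It is
    group-like, hence a single group element F a, and F is multiplicative because p is; Fourier
    inversion recovers P. *)
Lemma res_ker_hom : exists F : gT -> gT,
  [/\ {in A &, {morph F : x y / (x * y)%g}}, {in A, forall x, F x \in 'Z(G)%g}
    & forall y t, y \in A ->
        P y t = \sum_(b in A) fourier_coef A beta b y * (t == F b)%:R].
Proof.
pose Q a z := \sum_(c in A) beta a c * P c z.
have Qall a z : Q a z = \sum_c (if c \in A then beta a c else 0) * P c z.
  rewrite /Q big_mkcond; apply: eq_bigr => c _.
  by case: ifP => //; rewrite mul0r.
have Qdelta a : exists z, a \in A -> forall t, Q a t = (t == z)%:R.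
  case: (boolP (a \in A)) => [Aa|_]; last by exists 1%g.
  suff [z zP] : exists z, forall t, Q a t = (t == z)%:R by exists z.
  apply: orth_idem_delta => [t t'|]; last first.
    (* The sum of P c t over t is U c 1, which is 1 at c = s 1 = 1 and 0 elsewhere. *)
    rewrite exchange_big /=; have [s [sP sM _]] := U_perm fg.
    have s1 : s 1%g = 1%g by apply: (mulgI (s 1%g)); rewrite -sM !mulg1.
    under eq_bigr do rewrite -big_distrr /= [\sum_(i : gT) _]sP s1.
    rewrite (bigD1 1%g) //= big1 => [|c /andP[_ /negPf->]]; last by rewrite mulr0.
    by rewrite eqxx mulr1 addr0 (bicharC betaP) // (bichar1l betaP).
  rewrite [X in _ = X *+ _]/Q -sumrMnl big_distrlr exchange_big /=.
  transitivity (\sum_(d in A) \sum_(g in A) beta a g * (P (d^-1 * g)%g t * P d t')).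
    apply: eq_bigr => d Ad; rewrite (reindex_inj (mulgI d^-1%g)).
    apply: eq_big => [g|g]; rewrite groupMl ?groupV // => Ag.
    rewrite mulrACA -(bicharMr betaP) // ?groupM ?groupV //.
    by rewrite -(centralA (subsetIl _ _) _ Ad) mulKVg.
  rewrite exchange_big; apply: eq_bigr => g Ag.
  rewrite -mulrnAr P_comul big_distrr /= big_mkcond; apply: eq_bigr => d _.
  case: ifP => // /negbT nd; rewrite (contraNeq (@P_ZD d t')) //.
  by rewrite !mulr0.
have /fin_all_exists[F FP] := Qdelta; exists F; split=> [a b Aa Ab|a Aa|y t Ay].
- apply/esym/eqP/(@natr_bool_inj k); rewrite -FP ?groupM //.
  transitivity (\sum_z Q a z * Q b (z^-1 * (F a * F b))%g).
    under eq_bigr do rewrite big_distrlr /=.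
    rewrite exchange_big; apply: eq_bigr => c Ac; rewrite exchange_big /=.
    under eq_bigr do (under eq_bigr do rewrite mulrACA; rewrite -big_distrr P_mul /=).
    rewrite (bigD1 c) //= [X in _ + X]big1 => [|d /andP[_ nd]].
      by rewrite eqxx addr0 (bicharMl betaP).
    by rewrite eq_sym (negPf nd) mulr0.
  rewrite (bigD1 (F a)) //= big1 => [|z nz].
    by rewrite !FP // mulKg !eqxx mulr1 addr0.
  by rewrite FP // (negPf nz) mul0r.
- have := FP a Aa (F a); rewrite eqxx; apply: contra_eqT => nZ.
  rewrite /Q big1 1?eq_sym ?oner_eq0 // => c _.
  by rewrite (contraNeq (@P_centerr _ _ _ fg c (F a))) ?mulr0.
transitivity (\sum_(c in A)
    (\sum_(b in A) beta b c * fourier_coef A beta b y) * P c t).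
  rewrite (bigD1 y) //= [X in _ + X]big1 => [|c /andP[Ac nc]].
    by rewrite (fourier_invl chark betaP) // eqxx mul1r addr0.
  by rewrite (fourier_invl chark betaP) // eq_sym (negPf nc) mul0r.
under eq_bigr do rewrite big_distrl /=.
rewrite exchange_big; apply: eq_bigr => b Ab.
by rewrite -FP // big_distrr; apply: eq_bigr => c _; rewrite mulrAC mulrC.
Qed.

End ResKer.
End Kernel.

(** * The trivial group action, which is conjugation here since the two factors commute *)

Section TrivialAction.

Variables (aT rT : finGroupType) (D : {set aT}) (R : {set rT}).

Fact triv_is_action : is_action D (fun (x : rT) (_ : aT) => x).
Proof. by split=> [a x y|x a b _ _]. Qed.

Definition triv_action := Action triv_is_action.

Fact triv_is_groupAction : is_groupAction R triv_action.
Proof.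
move=> a Da; have -> : actperm triv_action a = 1%g.
  by apply/permP=> x; rewrite actpermE perm1.
by rewrite inE perm_on1; apply/morphicP=> x y _ _; rewrite !perm1.
Qed.

Definition triv_groupAction := GroupAction triv_is_groupAction.

End TrivialAction.

(** * The isomorphism onto the kernel *)

Section Isomorphism.

Import GRing.Theory.
Local Open Scope ring_scope.

Variables (k : closedFieldType) (gT : finGroupType).
Hypothesis chark : [pchar k] =i pred0.
Local Notation G := [set: gT].
Local Notation A := (ZD gT).
Local Notation act0 := (triv_groupAction (Aut_c' gT) (homZ A)).
Implicit Types (psi : hopfAut k gT) (chi : {ffun gT -> k}).

Variable beta : gT -> gT -> k.
Hypothesis betaP : nondeg_bichar A beta.

Let A_center : A \subset 'Z(G)%g := subsetIl _ _.
Let A_der : A \subset (G^`(1))%g := subsetIr _ _.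

(** [hom_map] takes a map on all of G but reads it only on A. *)
Definition ext_subg (f : {ffun subg_of A -> gT}) (x : gT) : gT := f (subg A x).

Lemma homZ_morph f : f \in homZ A ->
  {in A &, {morph ext_subg f : x y / (x * y)%g}}.
Proof.
rewrite inE => /andP[/morphicP fM _] x y Ax Ay.
by rewrite /ext_subg morphM // fM ?inE.
Qed.

Lemma homZ_center f : f \in homZ A -> {in A, forall x, ext_subg f x \in 'Z(G)%g}.
Proof. by rewrite inE => /andP[_ /forallP fZ] x _; apply: fZ. Qed.

Definition Phi (s : sdprod_by act0) : hopfAut k gT :=
  (hopf_of (hom_map A beta (ext_subg s.2)) * hopf_of (aut_map s.1))%g.

Lemma PhiE s a : Phi s a = aut_map s.1 (hom_map A beta (ext_subg s.2) a).
Proof.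
case: s => -[w f] /= /setXP[/= Dw Rf].
rewrite hopfAutM aut_map_hopf //= (hom_map_hopf chark betaP A_center) //.
  exact: homZ_morph.
exact: homZ_center.
Qed.

Lemma Phi_mul : {morph Phi : s t / (s * t)%g}.
Proof.
move=> s t; apply/hopfAut_eqP=> a; rewrite hopfAutM !PhiE.
case: s t => [[w f] /= /setXP[/= Dw Rf]] [[w' f'] /= /setXP[/= Dw' Rf']].
rewrite aut_map_hom_map // aut_map_comp; congr (aut_map _ _).
rewrite (hom_map_comp chark betaP).
apply: eq_hom_map => x Ax; rewrite /ext_subg ffunE.
by rewrite (centralF (homZ_center Rf')).
Qed.

Lemma Phi_basis s g h x t : Phi s (dbasis k g h) (x, t) =
  \sum_(b in A) fourier A beta b (fun y => (y == g)%:R) ((s.1^-1)%g x) *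
    (t == ext_subg s.2 b * h)%g%:R.
Proof. by rewrite PhiE aut_mapE hom_map_basisE. Qed.

Lemma Phi_res_ker s : res_ker (Phi s).
Proof.
apply/res_kerP => chi h cc; rewrite PhiE.
case: s => -[w f] /= /setXP[/= Dw Rf].
rewrite (hom_map_dpure_id chark betaP (homZ_morph Rf)) ?aut_map_dpure //.
  by case: cc.
by move=> x Ax; rewrite (is_char_der cc) ?(subsetP A_der).
Qed.

Lemma Phi_U s g x : coefU (Phi s) g x = (g == (s.1^-1)%g x)%:R.
Proof.
rewrite /coefU /coefM; under eq_bigr do rewrite Phi_basis.
rewrite exchange_big /=.
transitivity (\sum_(b in A) fourier A beta b (fun y => (y == g)%:R) ((s.1^-1)%g x)).
  apply: eq_bigr => b _; rewrite -big_distrr (bigD1 (ext_subg s.2 b)) //=.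
  rewrite mulg1 eqxx big1 => [|t /negPf nt]; first by rewrite addr0 mulr1.
  by rewrite nt.
rewrite exchange_big (bigD1 1%g) //= [X in _ + X]big1 => [|y /andP[Ay /negPf ny]].
  by rewrite -big_distrl /= (fourier_sum_l chark betaP) // eqxx mul1r mul1g addr0 eq_sym.
by rewrite -big_distrl /= (fourier_sum_l chark betaP) // ny mul0r.
Qed.

(** U recovers w by [Phi_U]; pairing the remaining coefficients with beta a isolates the term b = a
    and so recovers f at a. *)
Lemma Phi_inj : injective Phi.
Proof.
move=> s s' e; apply: val_inj => /=.
have ew : s.1 = s'.1.
  apply: invg_inj; apply/permP => x; apply/eqP/(@natr_bool_inj k).
  by rewrite -Phi_U -e Phi_U eqxx.
have ef a t : a \in A -> (t == ext_subg s.2 a) = (t == ext_subg s'.2 a).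
  (* The coefficient is taken at u.1 1 so that the inverse permutation in [Phi_basis] cancels. *)
  have Q (u : sdprod_by act0) : a \in A ->
      \sum_(g in A) beta a g * Phi u (dbasis k g 1%g) (u.1 1%g, t) =
      (t == ext_subg u.2 a)%:R.
    move=> Aa; under eq_bigr do rewrite Phi_basis permK big_distrr /=.
    have D b : b \in A -> \sum_(g in A) beta a g *
        (fourier A beta b (fun y => (y == g)%:R) 1 * (t == ext_subg u.2 b * 1)%g%:R) =
        (a == b)%:R * (t == ext_subg u.2 b)%:R.
      move=> Ab; rewrite mulg1; under eq_bigr do rewrite mulrA.
      rewrite -big_distrl /= -(fourier_invr chark betaP) //; congr (_ * _).
      apply: eq_bigr => g Ag; congr (_ * _); rewrite /fourier (bigD1 g) //= big1.
        by rewrite mulg1 eqxx mulr1 addr0.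
      by move=> y /andP[_ /negPf ny]; rewrite mulg1 ny mulr0.
    rewrite exchange_big (bigD1 a) //= [X in _ + X]big1 => [|b /andP[Ab nb]].
      by rewrite D // eqxx mul1r addr0.
    by rewrite D // eq_sym (negPf nb) mul0r.
  by move=> Aa; apply: (@natr_bool_inj k); rewrite -!Q // e ew.
rewrite [val s]surjective_pairing [val s']surjective_pairing /= ew; congr (_, _).
apply/ffunP=> x; have := ef (sgval x) (s.2 x) (subgP x).
by rewrite /ext_subg sgvalK eqxx => /esym/eqP.
Qed.

Lemma Phi_surj psi : res_ker psi -> exists s, Phi s = psi.
Proof.
move=> rk; have fg := res_ker_fixes_grp rk.
have [w cw ME] := res_ker_perm chark rk.
have [F [FM FZ FP]] := res_ker_hom chark rk betaP.
pose f := [ffun x : subg_of A => F (sgval x)].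
have Rf : f \in homZ A.
  rewrite inE; apply/andP; split.
    by apply/morphicP=> x y _ _; rewrite !ffunE FM ?subgP.
  by apply/forallP=> x; rewrite ffunE FZ ?subgP.
have wf : (w, f) \in setX (Aut_c' gT) (homZ A) by rewrite inE cw.
exists (SdPair act0 wf); apply/hopfAut_eqP => a.
rewrite (dsumE a) !linear_sum; apply: eq_bigr => -[g h] _ /=.
rewrite !linearZ; congr (_ *: _); apply/ffunP=> -[x t].
rewrite -[LHS]/(Phi (SdPair act0 wf) (dbasis k g h) (x, t)).
rewrite Phi_basis hopfaut_basis //= ME.
(* Only the translation by y carries w^-1 x to g, so both sides vanish unless y is in A. *)
set y := (g * _)%g; have yE u : (u * (w^-1)%g x == g)%g = (u == y).
  have cV : (w^-1)%g \in Aut_c' gT by rewrite groupV.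
  by rewrite /y (Aut_c'V cV) -[RHS](inj_eq (mulIg ((w^-1)%g x))) mulgKV.
case: (boolP (y \in A)) => [Ay|nAy]; last first.
  rewrite (contraNeq (@P_ZD _ _ chark _ rk _ _) nAy) // big1 // => b Ab.
  rewrite /fourier big1 ?mul0r // => u Au; rewrite yE.
  by case: eqP Au nAy => [-> -> //|]; rewrite mulr0.
rewrite FP //; apply: eq_bigr => b Ab.
rewrite /fourier (bigD1 y) //= big1 => [|u /andP[_ /negPf nu]]; last first.
  by rewrite yE nu mulr0.
rewrite yE eqxx mulr1 addr0; congr (_ * (_ : bool)%:R).
by rewrite /ext_subg ffunE subgK // -[RHS](inj_eq (mulIg h)) mulgKV.
Qed.

Lemma val_sdpair1 f : f \in homZ A -> val (sdpair1 act0 f) = (1%g, f).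
Proof. by move=> Rf; rewrite val_insubd inE /= group1 Rf. Qed.

Lemma val_sdpair2 w : w \in Aut_c' gT -> val (sdpair2 act0 w) = (w, 1%g).
Proof. by move=> Dw; rewrite val_insubd inE /= group1 Dw. Qed.

Lemma Phi_sdpair2 w g h : w \in Aut_c' gT ->
  Phi (sdpair2 act0 w) (dbasis k g h) = dbasis k (w g) h.
Proof.
move=> Dw; rewrite PhiE -[pair_of_sd _]/(val _) val_sdpair2 //= -aut_map_basis.
congr (aut_map _ _); rewrite -[RHS](hom_map1 chark betaP).
by apply: eq_hom_map => x _; rewrite /ext_subg ffunE.
Qed.

Lemma is_hom_aut_res_ker psi : is_hom_aut psi -> res_ker psi.
Proof.
move=> [uid vid rtriv ptriv]; have fg : fixes_grp psi by apply/Lambda_cP.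
apply/res_kerP => chi h cc.
have split_h : dpure chi h = dpure chi 1%g * dpure (feps k gT) h.
  rewrite dpureM ?mul1g; last exact: is_char_feps.
  by congr (dpure _ _); apply/ffunP=> x; rewrite !ffunE mulr1.
rewrite split_h hopfaut_mul fg; congr (_ * _).
have [chi' [h' [cc' e]]] := hopfaut_char psi 1%g cc.
have := uid chi; rewrite /comp_u e proj_fun_dpure => ->.
by have := ptriv chi cc; rewrite /comp_p e proj_grp_dpure // => /fbasis_inj->.
Qed.

Lemma comp_uE psi (f : {ffun gT -> k}) x : fixes_grp psi ->
  comp_u psi f x = \sum_g f g * coefU psi g x.
Proof.
move=> fg; rewrite ffunE; under eq_bigr do rewrite hopfaut_dpure //.
rewrite exchange_big; apply: eq_bigr => g _ /=; rewrite -big_distrr.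
by congr (_ * _); apply: eq_bigr => t _; rewrite invg1 mulg1.
Qed.

(** Such a psi lies in the kernel, hence is some [Phi s], and u = id forces the first component of s
    to be 1. *)
Lemma is_hom_autP psi : is_hom_aut psi <->
  exists2 f, f \in homZ A & Phi (sdpair1 act0 f) = psi.
Proof.
split=> [hpsi|[f Rf <-]].
  have rk := is_hom_aut_res_ker hpsi; have [s es] := Phi_surj rk.
  have s1 : s.1 = 1%g.
    apply: invg_inj; apply/permP => x; rewrite invg1 perm1.
    apply/esym/eqP/(@natr_bool_inj k).
    rewrite -Phi_U es; have [/(_ (fbasis k x))/ffunP/(_ x) + _ _ _] := hpsi.
    by rewrite [comp_u _ _ _]ffunE [fbasis _ _ _]ffunE eqxx.
  exists s.2; first by case: (s) => -[w f] /= /setXP[].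
  rewrite -es; congr (Phi _); apply: val_inj; rewrite val_sdpair1 /=; last first.
    by case: (s) => -[w f] /= /setXP[].
  by rewrite -s1 -surjective_pairing.
have rk := Phi_res_ker (sdpair1 act0 f).
have fg := res_ker_fixes_grp rk; have [vid rtriv] : Lambda_c (Phi (sdpair1 act0 f)).
  exact/Lambda_cP.
split=> // [f0|chi cc]; last first.
  by rewrite /comp_p (res_kerP _).1 // proj_grp_dpure.
apply/ffunP=> x; rewrite comp_uE // (bigD1 x) //= big1 => [|g ng]; rewrite Phi_U.
  by rewrite -[pair_of_sd _]/(val _) val_sdpair1 //= invg1 perm1 eqxx mulr1 addr0.
by rewrite -[pair_of_sd _]/(val _) val_sdpair1 //= invg1 perm1 (negPf ng) mulr0.
Qed.

(** The inclusion of A in Z(G) gives a kernel element that is trivial only if A is. If A = 1, then w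
    x * x^-1 lies in A and F is only read at 1, so both are trivial. *)
Lemma res_ker_trivial : (forall psi, res_ker psi -> psi = 1%g) <->
  ('Z(G) :&: G^`(1) = 1)%g.
Proof.
split=> [triv|A1 psi /Phi_surj[s <-]].
  pose f := [ffun x : subg_of A => sgval x].
  have Rf : f \in homZ A.
    rewrite inE; apply/andP; split.
      by apply/morphicP=> x y _ _; rewrite !ffunE.
    by apply/forallP=> x; rewrite ffunE (subsetP A_center) ?subgP.
  apply/trivgP/subsetP=> x Ax; rewrite inE.
  have : sdpair1 act0 f = 1%g.
    have Phi1 u : Phi u = 1%g := triv _ (Phi_res_ker u).
    by apply: Phi_inj; apply: etrans (Phi1 _) (esym (Phi1 _)).
  move/(congr1 val); rewrite val_sdpair1 //= => -[/ffunP/(_ (subg A x))].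
  by rewrite !ffunE subgK // => ->.
have xA1 x : x \in A -> x = 1%g by rewrite inE -in_setI A1 => /set1P.
apply/hopfAut_eqP => a; rewrite hopfAut1 PhiE.
case: s => -[w f] /= /setXP[/= Dw Rf].
have -> : w = 1%g.
  apply/permP => x; rewrite perm1; apply/eqP; rewrite -(inj_eq (mulIg x^-1%g)) mulgV.
  by apply/eqP/xA1/Aut_c'_ZD.
rewrite aut_map1 -[RHS](hom_map1 chark betaP); apply: eq_hom_map => x /xA1->.
exact: homF1 (homZ_morph Rf).
Qed.

End Isomorphism.

(** * When Lambda_c is contained in the kernel *)

Section DerivedCenter.

Import GRing.Theory.
Local Open Scope ring_scope.

Variables (k : closedFieldType) (gT : finGroupType).
Hypothesis chark : [pchar k] =i pred0.
Local Notation G := [set: gT].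

(** Take [hom_map] over B = Z(G) with F the identity. It belongs to Lambda_c, and if it fixes chi #
    1 then the Fourier transform of chi on B is concentrated at 1, so chi is 1 on Z(G). *)
Lemma center_sub_der : (forall psi : hopfAut k gT, Lambda_c psi -> res_ker psi) ->
  'Z(G)%g \subset (G^`(1))%g.
Proof.
move=> Lrk; pose B := 'Z(G)%G.
have [beta betaP] := nondeg_bichar_exists chark (center_abelian G).
have FM : {in B &, {morph id : x y / (x * y)%g}} by [].
have FZ : {in B, forall x, id x \in 'Z(G)%g} by [].
have psiE := hom_map_hopf chark betaP (subxx B) FM FZ.
have /Lrk/res_kerP rk : Lambda_c (hopf_of (hom_map B beta id) : hopfAut k gT).
  apply/Lambda_cP => h; rewrite psiE.
  by rewrite (hom_map_dpure_id chark betaP FM) // => [x y|x _]; rewrite !ffunE ?mulr1.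
apply/subsetP=> z Bz; apply: (is_char_separates chark) => chi cc.
have [c1 cM] := cc.
have sumE b : b \in B ->
    \sum_(y in B) fourier_coef B beta b y * chi y = (b == 1%g)%:R.
  move=> Bb; have := rk chi 1%g cc; rewrite psiE => /ffunP/(_ (1%g, b)).
  rewrite hom_map_dpure // dpureE c1 mul1r => <-.
  rewrite [RHS](bigD1 b) //= [X in _ + X]big1 => [|c /andP[_ /negPf nc]].
    by rewrite mulg1 eqxx mulr1 addr0.
  by rewrite mulg1 eq_sym nc mulr0.
(* Fourier inversion recovers chi z from its transform, which [sumE] has computed. *)
transitivity (\sum_(b in B) beta b z *
    \sum_(y in B) fourier_coef B beta b y * chi y).
  under [RHS]eq_bigr do rewrite big_distrr /=.
  rewrite exchange_big (bigD1 z) //= [X in _ + X]big1 => [|y /andP[By /negPf ny]].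
    under eq_bigr do rewrite mulrA.
    by rewrite -big_distrl /= (fourier_invl chark betaP) // eqxx mul1r addr0.
  under eq_bigr do rewrite mulrA.
  by rewrite -big_distrl /= (fourier_invl chark betaP) // ny mul0r.
rewrite (bigD1 1%g) //= [X in _ + X]big1 => [|b /andP[Bb /negPf nb]].
  by rewrite sumE // eqxx mulr1 addr0 (bichar1l betaP).
by rewrite sumE // nb mulr0.
Qed.

End DerivedCenter.

Import GroupScope.
Local Open Scope group_scope.

Theorem theorem6p7 (k : closedFieldType) (gT : finGroupType)
    (chark : [pchar k]%R =i pred0) :
  [/\ exists (to : groupAction (Aut_c' gT) (homZ (ZD gT)))
             (Phi : sdprod_by to -> hopfAut k gT),
        [/\ {morph Phi : s t / s * t},
            injective Phi,
            forall psi : hopfAut k gT, res_ker psi <-> exists s, Phi s = psi,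
            forall w, w \in Aut_c' gT -> forall g h : gT,
              Phi (sdpair2 to w) (dbasis k g h) = dbasis k (w g) h
          & forall psi : hopfAut k gT, is_hom_aut psi <->
              exists2 f, f \in homZ (ZD gT) & Phi (sdpair1 to f) = psi],
      (forall psi : hopfAut k gT, res_ker psi -> psi = 1) <->
        'Z([set: gT]) :&: [set: gT]^`(1) = 1,
      abelian [set: gT] \/ 'Z([set: gT]) = 1 ->
        forall psi : hopfAut k gT, res_ker psi -> psi = 1,
      'Z([set: gT]) \subset [set: gT]^`(1) <->
        forall psi : hopfAut k gT, res_ker psi <-> Lambda_c psi
    & 'Z([set: gT]) \subset [set: gT]^`(1) ->
        (~ (forall psi : hopfAut k gT, res_ker psi -> psi = 1)) <->
        'Z([set: gT]) <> 1].
Proof.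
have abA : abelian (ZD gT) := abelianS (subsetIl _ _) (center_abelian _).
have [beta betaP] := nondeg_bichar_exists chark abA.
have triv := res_ker_trivial chark betaP.
split=> //.
- exists (triv_groupAction _ _), (@Phi k gT beta); split.
  + exact: Phi_mul.
  + exact: Phi_inj.
  + by move=> psi; split=> [/(Phi_surj chark betaP)|[s <-]] //; apply: Phi_res_ker.
  + by move=> w Dw g h; apply: Phi_sdpair2.
  exact: is_hom_autP.
(* Either G' or Z(G) is trivial, hence so is their intersection. *)
- by move=> abZ; apply/triv; case: abZ => [/derG1P->|->]; rewrite ?setIg1 ?setI1g.
- split=> [sZ psi|Lrk].
    split=> [/res_ker_fixes_grp/Lambda_cP //|/Lambda_cP fg].
    exact: fixes_grp_res_ker.
  by apply: (center_sub_der chark) => psi /Lrk.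
by move/setIidPl => eZ; rewrite triv eZ.
Qed.
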